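(* Let $A$ be a differential graded commutative $R$-algebra, $V$ a differential graded $A$-module, and $C=\mathrm S[V]$ the graded symmetric $R$-coalgebra on $V$ with its coalgebra differential $d^0$. Let $\partial=\sum_{j\ge 1}\partial^j$ be a filtered degree $-1$ filtration lowering coderivation on $\mathrm S[V]$ and let $t=\sum_{j\ge1}t_j\colon \mathrm S[V]\to\mathrm{Der}(A|R)$ be a filtered degree $-1$ morphism. For $j\ge 1$ let $\mathcal D_j=\partial^{t_j}+\partial^{*}_j$ be the associated derivation of $\mathrm{Hom}(\mathrm S[V],A)$, and let $\mathcal D_0$ be the Hom-differential. Suppose that, for every $j\geq 1$, the derivation $\mathcal D_j$ of $\mathrm{Hom}(\mathrm S[V],A)$ (though not necessarily the individual constituents $\partial^{t_j}$ and $\partial^{*}_j$) passes to a derivation of $\mathrm{Sym}_A(V,A)$, and that $(\mathrm{Sym}_A(V,A),\mathcal D_0,\mathcal D_1,\mathcal D_2,\ldots)$ is a multi derivation chain algebra. Suppose, furthermore, that the canonical morphism of graded $A$-modules $$V\longrightarrow \mathrm{Hom}_A(\mathrm{Hom}_A(V,A),A)$$ from $V$ into its double $A$-dual is injective. Then $\partial$ is a coalgebra perturbation of the coalgebra differential $d^0$ of $C=\mathrm S[V]$ (that is, $(d^0+\partial)^2=0$), and $t$ is a Lie algebra twisting cochain $(C,d^0+\partial)\to\mathrm{Der}(A|R)$.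
   Context: Conventions. $R$ is a commutative ring containing $\mathbb Q$ as a subring; unadorned $\otimes$ and $\mathrm{Hom}$ are over $R$. Graded means $\mathbb Z$-graded (only homogeneous elements are considered); differentials have degree $-1$; the Eilenberg-Koszul sign convention is in force. The Hom-differential is $\mathcal D(f)=d\circ f+(-1)^{|f|+1}f\circ d$. $\mathrm{Der}(A|R)$ is the differential graded $R$-Lie algebra of graded $R$-linear derivations of $A$. Coalgebra. $\mathrm S[V]=\bigoplus_k\mathrm S^k[V]$ is the graded symmetric $R$-algebra on $V$, viewed as a coaugmented differential graded cocommutative $R$-coalgebra via the shuffle diagonal $\Delta$ (each $v\in V$ primitive), with differential $d^0$ induced from that of $V$. Its coaugmentation filtration is $C_j=\bigoplus_{k\le j}\mathrm S^k[V]$ (with $C_j=0$ for $j<0$). A filtered degree $-1$ filtration lowering coderivation on $C$ is a degree $-1$ coderivation $\partial=\sum_{j\ge1}\partial^j$ with each $\partial^j$ a coderivation that, when non-zero, lowers the coaugmentation filtration by $j$ (i.e. $\partial^j(C_k)\subseteq C_{k-j}$ for all $k$) but not by $j+1$. It is a coalgebra perturbation of $d^0$ when $d^0+\partial$ is a differential. A filtered degree $-1$ morphism $C\to\mathfrak g$ into a differential graded Lie algebra is a degree $-1$ $R$-module morphism $t=\sum_{j\ge1}t_j$ such that each $t_j$, if non-zero, is zero on $C_{j-1}$ but not on $C_j$. Given a coalgebra differential $d$ on $C$, a Lie algebra twisting cochain $(C,d)\to\mathfrak g$ is a degree $-1$ morphism $t$ which vanishes on the image of the coaugmentation $R\to C$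 and satisfies $\mathcal Dt+t\wedge t=0$, where $\mathcal Dt=d_{\mathfrak g}t+td$ and $t\wedge t=\tfrac12[t,t]$, the bracket being the cup bracket $[f,g]=[\cdot,\cdot]\circ(f\otimes g)\circ\Delta$ on $\mathrm{Hom}(C,\mathfrak g)$. Derivations. $\mathrm{Hom}(\mathrm S[V],A)$ is a differential graded commutative algebra under the cup product and the Hom-differential $\mathcal D_0$. For $j\ge1$, $\partial^{*}_j(\varphi)=(-1)^{|\varphi|+1}\varphi\circ\partial^j$, and $\partial^{t_j}(\varphi)=[t_j,\varphi]$ is the composite of $\Delta$, $t_j\otimes\varphi$, and the evaluation $\mathrm{Der}(A|R)\otimes A\to A$. $\mathrm{Sym}_A(V,A)=\mathrm{Hom}_A(\mathrm S_A[V],A)$, with $\mathrm S_A[V]$ the graded symmetric $A$-algebra on $V$, is the algebra of graded symmetric graded $A$-multilinear $A$-valued forms on $V$; it is the subalgebra of $\mathrm{Hom}(\mathrm S[V],A)$ of those forms that are graded $A$-multilinear on each $\mathrm S^k[V]$, $k\ge1$ (the degree $k=0$ part being $A$), and it is preserved by $\mathcal D_0$. A derivation of $\mathrm{Hom}(\mathrm S[V],A)$ passes to $\mathrm{Sym}_A(V,A)$ if it maps this subalgebra to itself. $\mathrm{Sym}_A(V,A)$ carries the descending filtration $\mathrm{Sym}_A(V,A)^{j}$, $j\ge0$, where $\mathrm{Sym}_A(V,A)^{j}$ consists of the forms vanishing on $C_{j-1}$. A multi derivation chain algebra is a differential graded commutative algebra $(\mathcal A,\mathcal D_0)$ with a descending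 filtration $\mathcal A=\mathcal A^0\supseteq\mathcal A^1\supseteq\cdots$ compatible with $\mathcal D_0$ and with degree $-1$ $R$-linear derivations $\mathcal D_j$ ($j\ge1$) such that each $\mathcal D_j$, when non-zero, lowers the filtration by $j$ ($\mathcal D_j(\mathcal A^\ell)\subseteq\mathcal A^{\ell+j}$ for all $\ell\geq 0$) but not by $j+1$, such that $\sum_{j\ge 1}\mathcal D_j$ converges (naively, or with respect to the filtration when it is complete), and such that $\sum_{j\ge0}\mathcal D_j$ is a differential. *)

(* Defs.v *)
From HB Require Import structures.
From mathcomp Require Import all_boot all_order all_algebra.
From mathcomp Require Import zify.
From mathcomp Require Import boolp classical_sets functions cardinality fsbigop.

Set Implicit Arguments.
Unset Strict Implicit.
Unset Printing Implicit Defensive.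
Import Order.TTheory GRing.Theory Num.Theory.
Local Open Scope classical_set_scope.
Local Open Scope ring_scope.
Local Open Scope quotient_scope.

Section Presented.
Variables (R : comNzRingType) (X : choiceType).
Variable P : forall M : lmodType R, (X -> M) -> Prop.

Definition lcomb (M : lmodType R) (f : X -> M) (l : seq (R * X)) : M :=
  \sum_(p <- l) p.1 *: f p.2.

Definition preq : rel (seq (R * X)) := fun l1 l2 =>
  `[< forall (M : lmodType R) (f : X -> M), P f -> lcomb f l1 = lcomb f l2 >].

Fact preq_refl : reflexive preq.
Proof. by move=> l; apply/asboolP. Qed.
Fact preq_sym : symmetric preq.
Proof.
by move=> l1 l2; apply/asboolP/asboolP => H M f /H.
Qed.
Fact preq_trans : transitive preq.
Proof.
move=> l2 l1 l3 /asboolP H1 /asboolP H2; apply/asboolP => M f Pf.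
by rewrite H1 // H2.
Qed.
Canonical preq_equiv := EquivRel preq preq_refl preq_sym preq_trans.

(* The R-module generated by X, universal for the maps f : X -> M into
   R-modules satisfying P: formal combinations, identified when every such
   map gives them the same value. *)
Definition presented : Type := {eq_quot preq}.
HB.instance Definition _ := Choice.on presented.
HB.instance Definition _ := EqQuotient.on presented.

Definition plift (M : lmodType R) (f : X -> M) (x : presented) : M :=
  lcomb f (repr x).
Definition pgen (x : X) : presented := \pi_presented [:: (1, x)].

Lemma plift_pi (M : lmodType R) (f : X -> M) l :
  P f -> plift f (\pi_presented l) = lcomb f l.
Proof.
move=> Pf; rewrite /plift.
have /eqmodP/asboolP/(_ M f Pf) -> // : repr (\pi_presented l) = l %[mod presented].
by rewrite reprK.
Qed.

Lemma presented_ext (x y : presented) :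
  (forall (M : lmodType R) (f : X -> M), P f -> plift f x = plift f y) -> x = y.
Proof.
move=> H; rewrite -[x]reprK -[y]reprK; apply/eqmodP/asboolP => M f Pf.
exact: H.
Qed.

Definition padd (x y : presented) := \pi_presented (repr x ++ repr y).
Definition pscale (r : R) (x : presented) :=
  \pi_presented [seq (r * p.1, p.2) | p <- repr x].
Definition popp (x : presented) := pscale (-1) x.
Definition pzero := \pi_presented [::].

Fact plift_add (M : lmodType R) (f : X -> M) x y :
  P f -> plift f (padd x y) = plift f x + plift f y.
Proof. by move=> Pf; rewrite plift_pi // /lcomb big_cat. Qed.
Fact plift_scale (M : lmodType R) (f : X -> M) r x :
  P f -> plift f (pscale r x) = r *: plift f x.
Proof.
move=> Pf; rewrite plift_pi // /lcomb big_map scaler_sumr.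
by apply: eq_bigr => p _; rewrite scalerA.
Qed.
Fact plift_zero (M : lmodType R) (f : X -> M) : P f -> plift f pzero = 0.
Proof. by move=> Pf; rewrite plift_pi // /lcomb big_nil. Qed.

Fact paddA : associative padd.
Proof. by move=> x y z; apply: presented_ext => M f Pf; rewrite !plift_add // addrA. Qed.
Fact paddC : commutative padd.
Proof. by move=> x y; apply: presented_ext => M f Pf; rewrite !plift_add // addrC. Qed.
Fact padd0 : left_id pzero padd.
Proof.
by move=> x; apply: presented_ext => M f Pf; rewrite plift_add // plift_zero // add0r.
Qed.
Fact paddN : left_inverse pzero popp padd.
Proof.
move=> x; apply: presented_ext => M f Pf.
by rewrite plift_add // plift_zero // plift_scale // scaleN1r addNr.
Qed.
HB.instance Definition _ := GRing.isZmodule.Build presented paddA paddC padd0 paddN.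

Fact pscaleA a b x : pscale a (pscale b x) = pscale (a * b) x.
Proof. by apply: presented_ext => M f Pf; rewrite !plift_scale // scalerA. Qed.
Fact pscale1 : left_id 1 pscale.
Proof. by move=> x; apply: presented_ext => M f Pf; rewrite plift_scale // scale1r. Qed.
Fact pscaleDr : right_distributive pscale +%R.
Proof.
move=> a x y; apply: presented_ext => M f Pf.
by rewrite plift_scale // !plift_add // !plift_scale // scalerDr.
Qed.
Fact pscaleDl x : {morph pscale^~ x : a b / a + b}.
Proof.
move=> a b /=; apply: presented_ext => M f Pf.
by rewrite plift_add // !plift_scale // scalerDl.
Qed.
HB.instance Definition _ :=
  GRing.Zmodule_isLmodule.Build R presented pscaleA pscale1 pscaleDr pscaleDl.

Lemma plift_linear (M : lmodType R) (f : X -> M) : P f -> linear (plift f).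
Proof. by move=> Pf a x y; rewrite plift_add // plift_scale. Qed.

Lemma plift_gen (M : lmodType R) (f : X -> M) x : P f -> plift f (pgen x) = f x.
Proof. by move=> Pf; rewrite plift_pi // /lcomb big_seq1 scale1r. Qed.

Lemma presentedE x : x = lcomb pgen (repr x).
Proof.
apply: presented_ext => M f Pf.
have sumE (l : seq (R * X)) : plift f (lcomb pgen l) = lcomb f l.
  elim: l => [|p l IHl]; first by rewrite /lcomb !big_nil; exact: plift_zero.
  by rewrite /lcomb !big_cons (plift_linear Pf) -/(lcomb _ _) IHl plift_gen.
by rewrite sumE.
Qed.

Lemma presented_ind (Q : presented -> Prop) :
  Q 0 -> (forall r x y, Q x -> Q y -> Q (r *: x + y)) ->
  (forall x, Q (pgen x)) -> forall x, Q x.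
Proof.
move=> Q0 QD Qg x; rewrite [x]presentedE /lcomb.
by elim: (repr x) => [|p l IHl]; rewrite ?big_nil // big_cons; apply: QD.
Qed.

End Presented.

Section Tensor.
Variables (R : comNzRingType) (M N : lmodType R).

Definition bilin (K : lmodType R) (f : M -> N -> K) : Prop :=
  (forall y, linear (f^~ y)) /\ (forall x, linear (f x)).

Definition tensor : Type :=
  presented (fun (K : lmodType R) (f : M * N -> K) => bilin (fun x y => f (x, y))).
HB.instance Definition _ := GRing.Lmodule.on tensor.

Definition tens (x : M) (y : N) : tensor := pgen _ (x, y).

Definition tlift (K : lmodType R) (f : M -> N -> K) (z : tensor) : K :=
  plift (fun p => f p.1 p.2) z.

Lemma tens_bilin : bilin tens.
Proof.
split=> [y r x x'|x r y y']; apply: presented_ext => K f Pf;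
  rewrite plift_linear // !plift_gen //; case: Pf => fl fr.
  exact: (fl y).
exact: (fr x).
Qed.

Lemma tlift_tens (K : lmodType R) (f : M -> N -> K) x y :
  bilin f -> tlift f (tens x y) = f x y.
Proof. by move=> bf; rewrite /tlift plift_gen. Qed.

Lemma tlift_linear (K : lmodType R) (f : M -> N -> K) :
  bilin f -> linear (tlift f).
Proof. by move=> bf; apply: plift_linear. Qed.

Lemma tensor_ind (Q : tensor -> Prop) :
  Q 0 -> (forall r x y, Q x -> Q y -> Q (r *: x + y)) ->
  (forall x y, Q (tens x y)) -> forall z, Q z.
Proof. by move=> Q0 QD Qt z; apply: presented_ind => // -[x y]; exact: Qt. Qed.

End Tensor.

Definition tmap (R : comNzRingType) (M N M' N' : lmodType R)
    (f : M -> M') (g : N -> N') : tensor M N -> tensor M' N' :=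
  tlift (fun x y => tens (f x) (g y)).

Lemma tmap_bilin (R : comNzRingType) (M N M' N' : lmodType R)
    (f : M -> M') (g : N -> N') :
  linear f -> linear g -> bilin (fun x y => tens (f x) (g y)).
Proof.
move=> lf lg; have [tl tr] := tens_bilin M' N'.
by split=> [y r x x'|x r y y'] /=; rewrite ?lf ?lg ?(tl (g y)) ?(tr (f x)).
Qed.

Lemma lin0 (R : comNzRingType) (M N : lmodType R) (f : M -> N) : linear f -> f 0 = 0.
Proof. by move=> lf; have := lf (-1) 0 0; rewrite !scaleN1r !addNr. Qed.

Lemma linZ (R : comNzRingType) (M N : lmodType R) (f : M -> N) r x :
  linear f -> f (r *: x) = r *: f x.
Proof. by move=> lf; have := lf r x 0; rewrite !addr0 lin0 // addr0. Qed.

Lemma linD (R : comNzRingType) (M N : lmodType R) (f : M -> N) x y :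
  linear f -> f (x + y) = f x + f y.
Proof. by move=> lf; have := lf 1 x y; rewrite !scale1r. Qed.

Lemma lin_sum (R : comNzRingType) (M N : lmodType R) (f : M -> N)
    (I : Type) (s : seq I) (F : I -> M) :
  linear f -> f (\sum_(i <- s) F i) = \sum_(i <- s) f (F i).
Proof.
move=> lf; elim: s => [|i s IHs]; first by rewrite !big_nil lin0.
by rewrite !big_cons linD // IHs.
Qed.

(* (-1)^n for an integer n *)
Definition ksign (R : comNzRingType) (n : int) : R := (-1) ^+ `|n|%N.
Arguments ksign {R} n.

Lemma ksignD (R : comNzRingType) m n : ksign (m + n) = ksign m * ksign n :> R.
Proof.
rewrite /ksign -exprD -signr_odd -[RHS]signr_odd; congr (_ ^+ nat_of_bool _).
lia.
Qed.

Lemma ksignN (R : comNzRingType) n : ksign (- n) = ksign n :> R.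
Proof. by rewrite /ksign abszN. Qed.

Lemma ksignK (R : comNzRingType) n : ksign n * ksign n = 1 :> R.
Proof. by rewrite -{2}ksignN -ksignD subrr. Qed.

HB.mixin Record isGraded (R : comNzRingType) M of GRing.Lmodule R M := {
  gproj : int -> M -> M;
  gproj_linear : forall n, linear (gproj n);
  gprojK : forall m n x, gproj m (gproj n x) = if m == n then gproj n x else 0;
  gproj_sum : forall x, exists2 s : seq int, uniq s & x = \sum_(n <- s) gproj n x
}.

(* Z-graded R-modules, as the internal direct sum of their homogeneous
   components; gproj n is the projection onto the component of degree n. *)
#[short(type="gmodType")]
HB.structure Definition GModule (R : comNzRingType) :=
  {M of isGraded R M & GRing.Lmodule R M}.

Definition homog (R : comNzRingType) (M : gmodType R) (n : int) (x : M) : Prop :=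
  gproj n x = x.

(* The additive extension to M of maps F n given on the homogeneous components *)
Definition hext (R : comNzRingType) (M : gmodType R) (N : lmodType R)
    (F : int -> M -> N) (x : M) : N :=
  \sum_(n \in [set: int]) F n (gproj n x).

Section GModuleTheory.
Variables (R : comNzRingType) (M : gmodType R).

Lemma gproj0 n : gproj n (0 : M) = 0.
Proof. by apply: lin0; exact: gproj_linear. Qed.

Lemma homog_gproj n (x : M) : homog n (gproj n x).
Proof. by rewrite /homog gprojK eqxx. Qed.

Lemma gproj_homog m n (x : M) : homog n x -> gproj m x = if m == n then x else 0.
Proof. by move=> hx; rewrite -hx gprojK. Qed.

Lemma homog_lin n r (x y : M) : homog n x -> homog n y -> homog n (r *: x + y).
Proof. by move=> hx hy; rewrite /homog gproj_linear hx hy. Qed.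

Lemma homog0 n : homog n (0 : M).
Proof. exact: gproj0. Qed.

Lemma gproj_supp (x : M) : exists2 s : seq int,
  uniq s & x = \sum_(n <- s) gproj n x /\ (forall n, n \notin s -> gproj n x = 0).
Proof.
have [s us xs] := gproj_sum x; exists s => //; split=> // n ns.
rewrite xs (lin_sum _ _ (gproj_linear n)).
rewrite big_seq big1 // => m ms; rewrite gprojK; case: eqP => // nm.
by rewrite nm ms in ns.
Qed.

Variables (N : lmodType R) (F : int -> M -> N).
Hypothesis linF : forall n, linear (F n).

Lemma hext_seq (s : seq int) x : uniq s -> (forall n, n \notin s -> gproj n x = 0) ->
  hext F x = \sum_(n <- s) F n (gproj n x).
Proof.
move=> us ns; rewrite /hext (fsbigE s) //.
  by apply: eq_bigl => i; rewrite in_setT.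
by move=> i _ /ns ->; exact: lin0.
Qed.

Lemma hext_linear : linear (hext F).
Proof.
move=> r x y; have [s us [_ sx]] := gproj_supp x; have [t ut [_ ty]] := gproj_supp y.
pose u := undup (s ++ t).
have uu : uniq u by exact: undup_uniq.
have ux n : n \notin u -> gproj n x = 0.
  by rewrite mem_undup mem_cat => /norP[/sx].
have uy n : n \notin u -> gproj n y = 0.
  by rewrite mem_undup mem_cat => /norP[_ /ty].
rewrite !(@hext_seq u) // ?scaler_sumr -?big_split /=.
  by apply: eq_bigr => n _; rewrite gproj_linear linF.
by move=> n nu; rewrite gproj_linear ux // uy // scaler0 addr0.
Qed.

Lemma hext_homog n x : homog n x -> hext F x = F n x.
Proof.
move=> hx; rewrite (@hext_seq [:: n]) ?big_seq1 ?hx // => m.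
by rewrite inE (gproj_homog _ hx) => /negPf ->.
Qed.

End GModuleTheory.

Lemma hext_arg_linear (R : comNzRingType) (M : gmodType R) (K N : lmodType R)
    (B : int -> M -> K -> N) x :
  (forall n, bilin (B n)) -> linear (fun k => hext (fun n y => B n y k) x).
Proof.
move=> bB r k k' /=; have [s us [_ sx]] := gproj_supp x.
rewrite !(@hext_seq _ _ _ _ _ s) // => [|n|n|n]; try by case: (bB n).
by rewrite scaler_sumr -big_split; apply: eq_bigr => n _; rewrite (bB n).2.
Qed.
HB.mixin Record hasDifferential (R : comNzRingType) M of GModule R M := {
  gdiff : M -> M;
  gdiff_linear : linear gdiff;
  gdiff_homog : forall n (x : M), homog n x -> homog (n - 1) (gdiff x);
  gdiffK : forall x, gdiff (gdiff x) = 0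
}.

#[short(type="dgmodType")]
HB.structure Definition DGModule (R : comNzRingType) :=
  {M of hasDifferential R M & GModule R M}.

(* The product is a field of its own because algType excludes the zero algebra. *)
HB.mixin Record isDGCAlgebra (R : comNzRingType) A of DGModule R A := {
  dgone : A;
  dgmul : A -> A -> A;
  dgmul_bilin : bilin dgmul;
  dgmulA : forall a b c, dgmul a (dgmul b c) = dgmul (dgmul a b) c;
  dgmul1l : forall a, dgmul dgone a = a;
  dgone_homog : homog 0 dgone;
  dgmul_homog : forall m n (a b : A),
    homog m a -> homog n b -> homog (m + n) (dgmul a b);
  dgmulC : forall m n (a b : A), homog m a -> homog n b ->
    dgmul a b = ksign (m * n) *: dgmul b a;
  dgmul_leibniz : forall m (a b : A), homog m a ->
    gdiff (dgmul a b) = dgmul (gdiff a) b + ksign m *: dgmul a (gdiff b)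
}.

#[short(type="dgcalgType")]
HB.structure Definition DGCAlgebra (R : comNzRingType) :=
  {A of isDGCAlgebra R A & DGModule R A}.

HB.mixin Record isDGModuleOver (R : comNzRingType) (A : dgcalgType R) V
    of DGModule R V := {
  act : A -> V -> V;
  act_bilin : bilin act;
  act1 : forall v, act dgone v = v;
  actA : forall a b v, act (dgmul a b) v = act a (act b v);
  act_homog : forall m n a (v : V), homog m a -> homog n v -> homog (m + n) (act a v);
  act_leibniz : forall m (a : A) v, homog m a ->
    gdiff (act a v) = act (gdiff a) v + ksign m *: act a (gdiff v)
}.

#[short(type="dgmodOverType")]
HB.structure Definition DGModuleOver (R : comNzRingType) (A : dgcalgType R) :=
  {V of isDGModuleOver R A V & DGModule R V}.

Section SymmetricCoalgebra.
Variables (R : comNzRingType) (V : gmodType R).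

(* Graded symmetric multilinear maps on words v1 ... vk of all lengths k *)
Definition gsymm (K : lmodType R) (f : seq V -> K) : Prop :=
  (forall s1 s2, linear (fun v => f (s1 ++ v :: s2))) /\
  (forall s1 s2 m n u v, homog m u -> homog n v ->
     f (s1 ++ u :: v :: s2) = ksign (m * n) *: f (s1 ++ v :: u :: s2)).

(* The R-module S[V]; word [:: v1; ...; vk] is the element v1 ... vk of S^k[V]. *)
Definition sym : Type := presented gsymm.
HB.instance Definition _ := GRing.Lmodule.on sym.

Definition word (w : seq V) : sym := pgen _ w.
Definition slift (K : lmodType R) (f : seq V -> K) (x : sym) : K := plift f x.

Lemma slift_word (K : lmodType R) (f : seq V -> K) w :
  gsymm f -> slift f (word w) = f w.
Proof. exact: plift_gen. Qed.

Lemma slift_linear (K : lmodType R) (f : seq V -> K) : gsymm f -> linear (slift f).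
Proof. exact: plift_linear. Qed.

Lemma word_gsymm : gsymm word.
Proof.
split=> [s1 s2 r u v|s1 s2 m n u v hu hv]; apply: presented_ext => K f Pf.
  rewrite (plift_linear Pf) !plift_gen //; exact: Pf.1.
rewrite -[ksign _ *: _]addr0 (plift_linear Pf) !plift_gen // (Pf.2 _ _ _ _ _ _ hu hv).
by rewrite -[LHS]addr0; congr (_ + _); apply/esym; exact: plift_zero.
Qed.

Lemma sym_ind (Q : sym -> Prop) :
  Q 0 -> (forall r x y, Q x -> Q y -> Q (r *: x + y)) ->
  (forall w, Q (word w)) -> forall x, Q x.
Proof. exact: presented_ind. Qed.

(* v.x for v in V and x in S[V] *)
Definition smul (v : V) : sym -> sym := slift (fun w => word (v :: w)).

Lemma cons_gsymm (K : lmodType R) (f : seq V -> K) v :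
  gsymm f -> gsymm (fun w => f (v :: w)).
Proof.
move=> [lf sf]; split=> [s1 s2|s1 s2 m n u u']; first exact: (lf (v :: s1)).
exact: (sf (v :: s1)).
Qed.

Lemma smul_word v w : smul v (word w) = word (v :: w).
Proof. by apply: slift_word; apply: cons_gsymm; exact: word_gsymm. Qed.

Lemma smul_linear v : linear (smul v).
Proof. by apply: slift_linear; apply: cons_gsymm; exact: word_gsymm. Qed.


Lemma smul_linearl x : linear (smul^~ x).
Proof.
move=> r u v; elim/sym_ind: x => [|a x y IHx IHy|w].
- by rewrite !(lin0 (smul_linear _)) scaler0 addr0.
- by rewrite !smul_linear IHx IHy !scalerDr !scalerA [a * r]mulrC addrACA.
by rewrite !smul_word; exact: (word_gsymm.1 [::] w).
Qed.

Lemma smulC m n u v x : homog m u -> homog n v ->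
  smul u (smul v x) = ksign (m * n) *: smul v (smul u x).
Proof.
move=> hu hv; elim/sym_ind: x => [|a x y IHx IHy|w].
- by rewrite !(lin0 (smul_linear _)) scaler0.
- by rewrite !smul_linear IHx IHy scalerDr !scalerA [a * _]mulrC.
by rewrite !smul_word; exact: (word_gsymm.2 [::] w).
Qed.

Fixpoint pword (w : seq V) (n : int) : sym :=
  if w is v :: w' then hext (fun p u => smul u (pword w' (n - p))) v
  else if n == 0 then word [::] else 0.

Fact pword_bilin (n p : int) :
  bilin (fun u (h : int -> sym) => smul u (h (n - p))).
Proof.
split=> [h r u v|u r h h']; first exact: smul_linearl.
exact: smul_linear.
Qed.

Lemma pword_gsymm : gsymm pword.
Proof.
split=> [s1 s2|s1 s2 m n u v hu hv].
  elim: s1 => [|a s1 IHs] r u v /=; apply: funext => n.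
    by rewrite hext_linear // => p; exact: smul_linearl.
  by rewrite IHs (hext_arg_linear a (pword_bilin n)).
elim: s1 => [|a s1 IHs] /=; apply: funext => k; last first.
  by rewrite IHs (linZ _ _ (hext_arg_linear a (pword_bilin k))).
rewrite [RHS]/= /GRing.scale /= !(hext_homog _ hu) ?(hext_homog _ hv);
  try by move=> p; exact: smul_linearl.
rewrite (hext_homog _ hu) => [|p]; last exact: smul_linearl.
by rewrite (smulC _ hu hv) addrAC.
Qed.

Fixpoint hword (n : int) (w : seq V) : Prop :=
  if w is v :: w' then exists2 p, homog p v & hword (n - p) w' else n = 0.

Lemma pword_hword m n w : hword m w -> pword w n = if n == m then word w else 0.
Proof.
elim: w m n => [|v w IHw] m n /=; first by move=> ->.
case=> p hv /IHw pw; rewrite (hext_homog _ hv) => [|q]; last exact: smul_linearl.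
rewrite pw (inj_eq (addIr _)); case: ifP => _; last exact: lin0 (smul_linear _).
exact: smul_word.
Qed.

Lemma sym_hind (Q : sym -> Prop) :
  Q 0 -> (forall r x y, Q x -> Q y -> Q (r *: x + y)) ->
  (forall n w, hword n w -> Q (word w)) -> forall x, Q x.
Proof.
move=> Q0 QD Qw; apply: (sym_ind Q0 QD) => w.
elim: w Q Q0 QD Qw => [|v w IHw] Q Q0 QD Qw; first exact: (Qw 0).
rewrite -smul_word; apply: (IHw (fun x => Q (smul v x))) => [|r x y Qx Qy|n w' hw'].
- by rewrite (lin0 (smul_linear _)).
- by rewrite smul_linear; exact: QD.
rewrite smul_word; have [s us ->] := gproj_sum v.
rewrite (lin_sum _ _ (word_gsymm.1 [::] w')).
elim: (s) => [|p t IHt]; rewrite ?big_nil // big_cons -[word _]scale1r; apply: QD => //.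
apply: (Qw (n + p)); exists p; first exact: homog_gproj.
by rewrite addrK.
Qed.

Definition sproj (n : int) : sym -> sym := slift (pword^~ n).

Lemma sproj_gsymm n : gsymm (pword^~ n).
Proof.
split=> [s1 s2 r u v|s1 s2 p q u v hu hv] /=.
  by rewrite (pword_gsymm.1 s1 s2).
by rewrite (pword_gsymm.2 s1 s2 _ _ _ _ hu hv).
Qed.

Lemma sproj_hword m n w : hword m w -> sproj n (word w) = if n == m then word w else 0.
Proof. by move=> hw; rewrite /sproj (slift_word _ (sproj_gsymm n)) (pword_hword _ hw). Qed.

Fact sproj_linear n : linear (sproj n).
Proof. exact: slift_linear (sproj_gsymm n). Qed.

Fact sprojK m n x : sproj m (sproj n x) = if m == n then sproj n x else 0.
Proof.
elim/sym_hind: x => [|r x y IHx IHy|p w hw].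
- by rewrite !(lin0 (sproj_linear _)) if_same.
- by rewrite !sproj_linear IHx IHy; case: ifP => // _; rewrite scaler0 addr0.
rewrite (sproj_hword n hw); case: (n =P p) => [->|_].
  exact: sproj_hword.
by rewrite (lin0 (sproj_linear _)) if_same.
Qed.

Fact sproj_sum x : exists2 s : seq int, uniq s & x = \sum_(n <- s) sproj n x.
Proof.
suff [s [us xs _]] : exists s : seq int,
    [/\ uniq s, x = \sum_(n <- s) sproj n x & forall n, n \notin s -> sproj n x = 0].
  by exists s.
elim/sym_hind: x => [|r x y [s [us xs ns]] [t [ut yt nt]]|n w hw].
- by exists [::]; split=> // [|n _]; rewrite ?big_nil // (lin0 (sproj_linear _)).
- have wid (z : sym) (u v : seq int) : uniq u -> uniq v -> {subset u <= v} ->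
      (forall n, n \notin u -> sproj n z = 0) ->
      \sum_(n <- v) sproj n z = \sum_(n <- u) sproj n z.
    move=> uu uv uv' nu; rewrite (bigID (mem u)) /= [X in _ + X]big1 // addr0.
    rewrite -big_filter; apply: perm_big; apply: uniq_perm => //.
      exact: filter_uniq.
    by move=> n; rewrite mem_filter; case: (boolP (n \in u)) => //= /uv' ->.
  exists (undup (s ++ t)); split; first exact: undup_uniq.
    under eq_bigr do rewrite sproj_linear.
    rewrite big_split -scaler_sumr /= {1}xs {1}yt; congr (_ *: _ + _);
      apply/esym; apply: wid => //; try exact: undup_uniq;
      by move=> n; rewrite mem_undup mem_cat => ->; rewrite ?orbT.
  move=> n; rewrite mem_undup mem_cat => /norP[/ns nx /nt ny].
  by rewrite sproj_linear nx ny scaler0 addr0.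
exists [:: n]; split=> // [|m]; first by rewrite big_seq1 (sproj_hword _ hw) eqxx.
by rewrite inE (sproj_hword _ hw) => /negPf ->.
Qed.

HB.instance Definition _ :=
  isGraded.Build R sym sproj_linear sprojK sproj_sum.

Lemma homog_word n w : hword n w -> homog n (word w).
Proof. by move=> hw; rewrite /homog /= /gproj /= (sproj_hword _ hw) eqxx. Qed.

End SymmetricCoalgebra.

(* x |-> (-1)^(n |x|) x, the sign for moving a map of degree n past x *)
Definition koszul (R : comNzRingType) (M : gmodType R) (n : int) : M -> M :=
  hext (fun p x => ksign (n * p) *: x).

Fact scale_lin (R : comNzRingType) (M : lmodType R) (r : R) :
  linear (fun x : M => r *: x).
Proof. by move=> a x y; rewrite scalerDr !scalerA [r * a]mulrC. Qed.

Section Koszul.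
Variables (R : comNzRingType) (M : gmodType R).

Lemma koszul_linear n : linear (@koszul R M n).
Proof. by apply: hext_linear => p; exact: scale_lin. Qed.

Lemma koszul_homog n p (x : M) : homog p x -> koszul n x = ksign (n * p) *: x.
Proof. by move=> hx; rewrite /koszul (hext_homog _ hx) // => q; exact: scale_lin. Qed.

End Koszul.

Section Coalgebra.
Variables (R : comNzRingType) (V : gmodType R).

Lemma gproj_smul m n (v : V) x : homog n v ->
  gproj m (smul v x) = smul v (gproj (m - n) x).
Proof.
move=> hv; elim/sym_hind: x => [|r x y IHx IHy|p w hw].
- by rewrite (lin0 (smul_linear _)) !gproj0 (lin0 (smul_linear _)).
- by rewrite smul_linear !gproj_linear smul_linear IHx IHy.
rewrite smul_word (gproj_homog _ (homog_word hw)) (gproj_homog _ (n := n + p)).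
  rewrite subr_eq [p + n]addrC; case: ifP => _; last by rewrite (lin0 (smul_linear _)).
  by rewrite smul_word.
by apply: homog_word; exists n => //; rewrite [n + p]addrC addrK.
Qed.

Lemma homog_smul m n (v : V) x : homog m v -> homog n x -> homog (m + n) (smul v x).
Proof.
by move=> hv hx; rewrite /homog (gproj_smul _ _ hv) [m + n]addrC addrK hx.
Qed.

Definition counit : sym V -> R :=
  @slift R V R^o (fun w => if w is [::] then 1 else 0).

Let T := tensor (sym V) (sym V).

(* v (x) 1 + 1 (x) v acting on the tensor square of S[V] from the left, where
   (1 (x) v) (x' (x) x'') = (-1)^(|v||x'|) x' (x) v x''. *)
Definition dmul (v : V) (z : T) : T :=
  tmap (smul v) id z + hext (fun p u => tmap (koszul p) (smul u) z) v.

(* The shuffle diagonal is the algebra morphism for which each v is primitive. *)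
Fixpoint wdiag (w : seq V) : T :=
  if w is v :: w' then dmul v (wdiag w') else tens (word [::]) (word [::]).

Definition diag : sym V -> T := slift wdiag.

Lemma counit_gsymm : gsymm (fun w : seq V => (if w is [::] then 1 else 0) : R^o).
Proof.
by split=> [[|a s1] s2 r u v|[|a s1] s2 m n u v hu hv] /=; rewrite scaler0 ?addr0.
Qed.

Lemma tmapE (M N M' N' : lmodType R) (f : M -> M') (g : N -> N') x y :
  linear f -> linear g -> tmap f g (tens x y) = tens (f x) (g y).
Proof. by move=> lf lg; rewrite /tmap tlift_tens //; exact: tmap_bilin. Qed.

Lemma tmap_linear (M N M' N' : lmodType R) (f : M -> M') (g : N -> N') :
  linear f -> linear g -> linear (tmap f g).
Proof. by move=> lf lg; apply: tlift_linear; exact: tmap_bilin. Qed.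

Fact id_linear (M : lmodType R) : linear (@id M).
Proof. by []. Qed.

Lemma tensor_hind (N : lmodType R) (Q : tensor (sym V) N -> Prop) :
  Q 0 -> (forall r x y, Q x -> Q y -> Q (r *: x + y)) ->
  (forall n x y, homog n x -> Q (tens x y)) -> forall z, Q z.
Proof.
move=> Q0 QD Qt; apply: (tensor_ind Q0 QD) => x y.
have [s _ ->] := gproj_sum x.
rewrite (lin_sum _ _ ((tens_bilin (sym V) N).1 y)).
elim: (s) => [|p t IHt]; rewrite ?big_nil // big_cons -[tens _ _]scale1r.
by apply: QD => //; apply: (Qt p); exact: homog_gproj.
Qed.

Lemma bilin_ext (K : lmodType R) (F : V -> T -> K) :
  (forall v, linear (F v)) -> (forall x y, linear (fun v => F v (tens x y))) ->
  bilin F.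
Proof.
move=> lF ltF; split=> // z r u v.
elim/tensor_ind: z => [|a x y IHx IHy|x y]; last exact: ltF.
  by rewrite !(lin0 (lF _)) scaler0 addr0.
by rewrite !lF IHx IHy !scalerDr !scalerA [a * r]mulrC addrACA.
Qed.

Lemma linear_ext (K : lmodType R) (F G : T -> K) :
  linear F -> linear G ->
  (forall n x y, homog n x -> F (tens x y) = G (tens x y)) -> F =1 G.
Proof.
move=> lF lG FG; elim/tensor_hind => [|a x y IHx IHy|n x y hx]; last exact: (FG n).
  by rewrite !lin0.
by rewrite lF lG IHx IHy.
Qed.

Fact smull_bilin : bilin (fun v (z : T) => tmap (smul v) id z).
Proof.
apply: bilin_ext => [v|x y r u v]; first by apply: tmap_linear; [exact: smul_linear|].
by rewrite !tmapE //; try exact: smul_linear; rewrite smul_linearl (tens_bilin _ _).1.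
Qed.

Fact smulr_bilin p : bilin (fun v (z : T) => tmap (koszul p) (smul v) z).
Proof.
apply: bilin_ext => [v|x y r u v].
  by apply: tmap_linear; [exact: koszul_linear|exact: smul_linear].
rewrite !tmapE; try exact: smul_linear; try exact: koszul_linear.
by rewrite smul_linearl (tens_bilin _ _).2.
Qed.

Lemma dmul_bilin : bilin dmul.
Proof.
split=> [z r u v|v r z z']; rewrite /dmul.
  rewrite smull_bilin.1 hext_linear; last by move=> p; exact: (smulr_bilin p).1.
  by rewrite scalerDr addrACA.
rewrite smull_bilin.2 (hext_arg_linear v smulr_bilin).
by rewrite scalerDr addrACA.
Qed.

Lemma dmul_tens n p (v : V) x y : homog n v -> homog p x ->
  dmul v (tens x y) = tens (smul v x) y + ksign (n * p) *: tens x (smul v y).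
Proof.
move=> hv hx; rewrite /dmul (hext_homog _ hv); last by move=> q; exact: (smulr_bilin q).1.
rewrite !tmapE //; try exact: smul_linear; try exact: koszul_linear.
by rewrite (koszul_homog _ hx) (linZ _ _ ((tens_bilin _ _).1 _)).
Qed.

Fact dmulC_sign (K : lmodType R) (a b c : R) (A B C D : K) : a * a = 1 ->
  a *: A + (a * b) *: B + c *: (C + b *: (a *: D)) =
  a *: (A + (a * c) *: C + b *: (B + c *: D)).
Proof.
move=> aa; rewrite !scalerDr !scalerA mulrA aa mul1r -!addrA; congr (_ + _).
by rewrite addrCA; congr (_ + (_ + _ *: _)); rewrite mulrC mulrA mulrAC.
Qed.

Lemma dmulC m n (u v : V) z : homog m u -> homog n v ->
  dmul u (dmul v z) = ksign (m * n) *: dmul v (dmul u z).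
Proof.
move=> hu hv; have lD w : linear (dmul w) := dmul_bilin.2 w.
pose F z := dmul u (dmul v z); pose G z := ksign (m * n) *: dmul v (dmul u z).
apply: (@linear_ext T F G) => [r x y|r x y|p x y hx]; rewrite /F /G.
- by rewrite !lD.
- by rewrite !lD scale_lin.
rewrite (dmul_tens _ hv hx) (dmul_tens _ hu hx) !(linD _ _ (lD _)) !(linZ _ _ (lD _)).
rewrite !(dmul_tens _ hv hx, dmul_tens _ hu hx,
  dmul_tens _ hu (homog_smul hv hx), dmul_tens _ hv (homog_smul hu hx)).
rewrite (smulC x hu hv) (smulC y hu hv) (linZ _ _ ((tens_bilin _ _).1 _))
  (linZ _ _ ((tens_bilin _ _).2 _)) !mulrDr !ksignD [n * m]mulrC.
by apply: dmulC_sign; exact: ksignK.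
Qed.

Lemma wdiag_gsymm : gsymm wdiag.
Proof.
have wcons v w : wdiag (v :: w) = dmul v (wdiag w) by [].
split=> [s1 s2|s1 s2 m n u v hu hv].
  elim: s1 => [|a s1 IHs] r u v; first exact: dmul_bilin.1.
  by rewrite !cat_cons !wcons IHs dmul_bilin.2.
elim: s1 => [|a s1 IHs]; first exact: dmulC.
by rewrite !cat_cons !wcons IHs (linZ _ _ (dmul_bilin.2 _)).
Qed.

Lemma diag_word w : diag (word w) = wdiag w.
Proof. by rewrite /diag (slift_word _ wdiag_gsymm). Qed.

End Coalgebra.

(* d(v x) = (dv) x + (-1)^|v| v (dx) *)
Fixpoint wdiff (R : comNzRingType) (V : dgmodType R) (w : seq V) : sym V :=
  if w is v :: w' then
    word (gdiff v :: w') + hext (fun p u => ksign p *: smul u (wdiff w')) v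
  else 0.

Definition sdiff (R : comNzRingType) (V : dgmodType R) : sym V -> sym V :=
  slift (@wdiff R V).

Arguments word_gsymm {R V}.

Section SDiff.
Variables (R : comNzRingType) (V : dgmodType R).

Fact wdiffr_bilin p : bilin (fun (u : V) (x : sym V) => ksign p *: smul u x).
Proof.
by split=> [x r u v|u r x y]; rewrite ?smul_linearl ?smul_linear scale_lin.
Qed.

Lemma wdiff_gsymm : gsymm (@wdiff R V).
Proof.
split=> [s1 s2|s1 s2 m n u v hu hv].
  elim: s1 => [|a s1 IHs] r u v /=.
    rewrite gdiff_linear (word_gsymm.1 [::] s2) hext_linear; last first.
      by move=> p; exact: (wdiffr_bilin p).1.
    by rewrite scalerDr addrACA.
  rewrite IHs (hext_arg_linear a wdiffr_bilin) (word_gsymm.1 (gdiff a :: s1) s2).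
  by rewrite scalerDr addrACA.
have lp p x := (wdiffr_bilin p).1 x.
elim: s1 => [|a s1 IHs]; last first.
  rewrite !cat_cons /= IHs (linZ _ _ (hext_arg_linear a wdiffr_bilin)).
  by rewrite (word_gsymm.2 (gdiff a :: s1) s2 _ _ _ _ hu hv) scalerDr.
rewrite /= !(hext_homog _ hu) ?(hext_homog _ hv) ?(hext_homog _ hu) //.
rewrite !(linD _ _ (smul_linear _)) !(linZ _ _ (smul_linear _)) !smul_word.
have -> : word [:: gdiff u, v & s2] = ksign (m * n) * ksign n *: word [:: v, gdiff u & s2].
  rewrite (word_gsymm.2 [::] s2 _ _ _ _ (gdiff_homog _ _ hu) hv).
  by rewrite mulrBl mul1r ksignD ksignN.
have -> : word [:: gdiff v, u & s2] = ksign (m * n) * ksign m *: word [:: u, gdiff v & s2].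
  rewrite (word_gsymm.2 [::] s2 _ _ _ _ (gdiff_homog _ _ hv) hu).
  by rewrite mulrBl mul1r ksignD ksignN [n * m]mulrC.
rewrite (smulC _ hu hv) !scalerDr !scalerA !mulrA ksignK mul1r.
rewrite addrCA; congr (_ + (_ + _ *: _)).
by rewrite mulrC [X in _ * X]mulrC mulrA.
Qed.

Lemma sdiff_word (w : seq V) : sdiff (word w) = wdiff w.
Proof. by rewrite /sdiff (slift_word _ wdiff_gsymm). Qed.

End SDiff.

Definition is_hom (R : comNzRingType) (M N : gmodType R) (n : int) (f : M -> N) : Prop :=
  linear f /\ forall p x, homog p x -> homog (n + p) (f x).

(* s = \sum_(j >= 1) u j, the sum being finite on each argument *)
Definition pointwise_sum (X : Type) (Y : zmodType) (u : nat -> X -> Y) (s : X -> Y) : Prop :=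
  forall x, exists N : nat, forall k, (N <= k)%N -> s x = \sum_(1 <= j < k.+1) u j x.

Section Coderivations.
Variables (R : comNzRingType) (V : gmodType R).

(* C_j = \bigoplus_(k <= j) S^k[V]; in particular C_j = 0 for j < 0. *)
Definition coaug_fil (j : int) (x : sym V) : Prop :=
  exists l : seq (R * seq V),
    (forall p, p \in l -> (size p.2)%:Z <= j) /\ x = lcomb (@word R V) l.

Definition coderivation (n : int) (f : sym V -> sym V) : Prop :=
  is_hom n f /\
  forall x, diag (f x) = tmap f id (diag x) + tmap (koszul n) f (diag x).

Definition lowers_coaug (j : nat) (f : sym V -> sym V) : Prop :=
  forall k x, coaug_fil k x -> coaug_fil (k - j%:Z) (f x).

Definition filtered_coderivation (pd : sym V -> sym V) (pdj : nat -> sym V -> sym V) : Prop :=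
  [/\ coderivation (-1) pd,
      forall j, (0 < j)%N ->
        [/\ coderivation (-1) (pdj j), lowers_coaug j (pdj j) &
            (exists x, pdj j x <> 0) -> ~ lowers_coaug j.+1 (pdj j)] &
      pointwise_sum pdj pd].

Definition coalg_differential (d : sym V -> sym V) : Prop :=
  coderivation (-1) d /\ forall x, d (d x) = 0.

(* With f and g of degrees m and n and beta a pairing on homogeneous elements
   (of the degrees given as its first arguments), the composite
   beta o (f (x) g) o Delta. *)
Definition cup (P Q W : lmodType R) (beta : int -> int -> P -> Q -> W)
    (m : int) (f : sym V -> P) (n : int) (g : sym V -> Q) (x : sym V) : W :=
  tlift (fun x1 x2 =>
    hext (fun p y1 =>
      hext (fun q y2 => ksign (n * p) *: beta (m + p) (n + q) (f y1) (g y2)) x2) x1)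
    (diag x).

End Coderivations.

Section Derivations.
Variables (R : comNzRingType) (A : dgcalgType R).

(* Der(A|R)_n, inside the R-module of all functions A -> A *)
Definition is_der (n : int) (delta : A -> A) : Prop :=
  is_hom n delta /\
  forall p a b, homog p a ->
    delta (dgmul a b) = dgmul (delta a) b + ksign (n * p) *: dgmul a (delta b).

Definition der_bracket (m n : int) (delta eps : A -> A) : A -> A :=
  fun a => delta (eps a) - ksign (m * n) *: eps (delta a).

(* The differential [d, delta] of Der(A|R), for delta of degree n *)
Definition der_diff (n : int) (delta : A -> A) : A -> A :=
  fun a => gdiff (delta a) + ksign (n + 1) *: delta (gdiff a).

Variable V : gmodType R.

Definition der_hom (n : int) (t : sym V -> (A -> A)) : Prop :=
  linear t /\ forall p x, homog p x -> is_der (n + p) (t x).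

Definition vanishes_on_coaug (Y : zmodType) (j : int) (f : sym V -> Y) : Prop :=
  forall x, coaug_fil j x -> f x = 0.

Definition filtered_morphism (t : sym V -> (A -> A)) (tj : nat -> sym V -> (A -> A)) : Prop :=
  [/\ der_hom (-1) t,
      forall j, (0 < j)%N ->
        [/\ der_hom (-1) (tj j), vanishes_on_coaug (j%:Z - 1) (tj j) &
            (exists x, tj j x <> 0) -> ~ vanishes_on_coaug j%:Z (tj j)] &
      pointwise_sum tj t].

(* The Maurer-Cartan equation is D t + 1/2 [t, t] = 0; the embedding iota of
   the rationals provides 1/2. *)
Definition twisting_cochain (iota : {rmorphism rat -> R})
    (d : sym V -> sym V) (t : sym V -> (A -> A)) : Prop :=
  [/\ der_hom (-1) t,
      t (word [::]) = 0 &
      forall p x, homog p x ->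
        der_diff (-1 + p) (t x) + t (d x) +
        iota (2^-1) *: cup der_bracket (-1) t (-1) t x = 0].

End Derivations.

(* Graded algebras and multi derivation chain algebras whose component of degree n is the
   submodule comp n of an ambient module U; operations take the degrees of their
   (homogeneous) arguments as parameters. *)
Section MultiDerivation.
Variables (R : comNzRingType) (U : lmodType R) (comp : int -> U -> Prop).
Variables (one : U) (mul : int -> int -> U -> U -> U).

Definition submod (S : U -> Prop) : Prop :=
  S 0 /\ forall r x y, S x -> S y -> S (r *: x + y).

Definition derivation_on (D : int -> U -> U) : Prop :=
  [/\ forall n x, comp n x -> comp (n - 1) (D n x),
      forall n r x y, comp n x -> comp n y -> D n (r *: x + y) = r *: D n x + D n y &
      forall m n x y, comp m x -> comp n y ->
        D (m + n) (mul m n x y) =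
          mul (m - 1) n (D m x) y + ksign m *: mul m (n - 1) x (D n y)].

Record dgc_algebra (D0 : int -> U -> U) : Prop := {
  dgc_comp : forall n, submod (comp n);
  dgc_one : comp 0 one;
  dgc_mul : forall m n x y, comp m x -> comp n y -> comp (m + n) (mul m n x y);
  dgc_mul_linl : forall m n r x x' y, comp m x -> comp m x' -> comp n y ->
    mul m n (r *: x + x') y = r *: mul m n x y + mul m n x' y;
  dgc_mul_linr : forall m n r x y y', comp m x -> comp n y -> comp n y' ->
    mul m n x (r *: y + y') = r *: mul m n x y + mul m n x y';
  dgc_mulA : forall m n p x y z, comp m x -> comp n y -> comp p z ->
    mul m (n + p) x (mul n p y z) = mul (m + n) p (mul m n x y) z;
  dgc_mul1l : forall n x, comp n x -> mul 0 n one x = x;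
  dgc_mulC : forall m n x y, comp m x -> comp n y ->
    mul m n x y = ksign (m * n) *: mul n m y x;
  dgc_derivation : derivation_on D0;
  dgc_square0 : forall n x, comp n x -> D0 (n - 1) (D0 n x) = 0
}.

Variable fil : nat -> U -> Prop.

Definition raises_fil (j : nat) (D : int -> U -> U) : Prop :=
  forall n l x, comp n x -> fil l x -> fil (l + j) (D n x).

Definition fil_limit (u : nat -> U) (y : U) : Prop :=
  forall l, exists N : nat, forall k, (N <= k)%N -> fil l (y - u k).

Definition fil_complete : Prop :=
  (forall n x, comp n x -> (forall l, fil l x) -> x = 0) /\
  (forall n (u : nat -> U), (forall k, comp n (u k)) ->
     (forall l, exists N : nat, forall i k, (N <= i)%N -> (N <= k)%N -> fil l (u i - u k)) ->
     exists2 y, comp n y & fil_limit u y).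

(* Dsum = \sum_(j >= 0) D j, either naively (the sum being finite on each element)
   or with respect to a complete filtration *)
Definition converges_to (D0 : int -> U -> U) (D : nat -> int -> U -> U)
    (Dsum : int -> U -> U) : Prop :=
  (forall n x, comp n x -> exists N : nat, forall k, (N <= k)%N ->
     Dsum n x = D0 n x + \sum_(1 <= j < k.+1) D j n x) \/
  (fil_complete /\
   forall n x, comp n x ->
     fil_limit (fun k => D0 n x + \sum_(1 <= j < k.+1) D j n x) (Dsum n x)).

Record multi_derivation_algebra (D0 : int -> U -> U) (D : nat -> int -> U -> U) : Prop := {
  mda_dgc : dgc_algebra D0;
  mda_fil_submod : forall n j, submod (fun x => comp n x /\ fil j x);
  mda_fil0 : forall n x, comp n x -> fil 0 x;
  mda_fil_desc : forall n j x, comp n x -> fil j.+1 x -> fil j x;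
  mda_fil_D0 : raises_fil 0 D0;
  mda_derivation : forall j, (0 < j)%N -> derivation_on (D j);
  mda_raises : forall j, (0 < j)%N -> raises_fil j (D j);
  mda_raises_max : forall j, (0 < j)%N ->
    (exists n x, comp n x /\ D j n x <> 0) -> ~ raises_fil j.+1 (D j);
  mda_sum : exists Dsum : int -> U -> U,
    [/\ forall n x, comp n x -> comp (n - 1) (Dsum n x),
        converges_to D0 D Dsum &
        forall n x, comp n x -> Dsum (n - 1) (Dsum n x) = 0]
}.

End MultiDerivation.

Section Forms.
Variables (R : comNzRingType) (A : dgcalgType R).

Definition hom_diff (V : dgmodType R) (n : int) (phi : sym V -> A) : sym V -> A :=
  fun x => gdiff (phi x) + ksign (n + 1) *: phi (sdiff x).

Definition hom_one (V : gmodType R) : sym V -> A := fun x => counit x *: dgone.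

Definition hom_mul (V : gmodType R) (m n : int) (phi psi : sym V -> A) : sym V -> A :=
  cup (fun _ _ => dgmul) m phi n psi.

(* phi |-> [t, phi], for t of degree -1 *)
Definition der_of_morphism (V : gmodType R) (t : sym V -> (A -> A))
    (n : int) (phi : sym V -> A) : sym V -> A :=
  cup (fun _ _ (delta : A -> A) a => delta a) (-1) t n phi.

Definition der_of_coder (V : gmodType R) (pd : sym V -> sym V)
    (n : int) (phi : sym V -> A) : sym V -> A :=
  fun x => ksign (n + 1) *: phi (pd x).

Definition multi_der (V : gmodType R) (pdj : nat -> sym V -> sym V)
    (tj : nat -> sym V -> (A -> A)) (j : nat) (n : int) (phi : sym V -> A) : sym V -> A :=
  fun x => der_of_morphism (tj j) n phi x + der_of_coder (pdj j) n phi x.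

Variable V : dgmodOverType A.

(* The component of degree n of Sym_A(V, A), as a subalgebra of Hom(S[V], A) *)
Definition Sym_A (n : int) (phi : sym V -> A) : Prop :=
  is_hom n phi /\
  forall p q a (s1 s2 : seq V) v, homog p a -> homog q (word s1) ->
    phi (word (s1 ++ act a v :: s2)) =
      ksign (p * (n + q)) *: dgmul a (phi (word (s1 ++ v :: s2))).

Definition Sym_A_fil (j : nat) (phi : sym V -> A) : Prop :=
  vanishes_on_coaug (j%:Z - 1) phi.

Definition passes_to_Sym_A (D : int -> (sym V -> A) -> (sym V -> A)) : Prop :=
  forall n phi, Sym_A n phi -> Sym_A (n - 1) (D n phi).

Definition Hom_A (n : int) (psi : V -> A) : Prop :=
  is_hom n psi /\
  forall p a v, homog p a -> psi (act a v) = ksign (n * p) *: dgmul a (psi v).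

(* The image of v, of degree p, in the double A-dual: psi |-> (-1)^(|v||psi|) psi v *)
Definition bidual (p : int) (v : V) (n : int) (psi : V -> A) : A :=
  ksign (p * n) *: psi v.

Definition bidual_injective : Prop :=
  forall p (v w : V), homog p v -> homog p w ->
    (forall n psi, Hom_A n psi -> bidual p v n psi = bidual p w n psi) -> v = w.

End Forms.

(* Main.v *)
Require Import Defs.
From mathcomp Require Import all_boot all_order all_algebra.
From mathcomp Require Import boolp classical_sets functions.
From mathcomp Require Import ring zify.

Set Implicit Arguments.
Unset Strict Implicit.
Unset Printing Implicit Defensive.
Import GRing.Theory.
Local Open Scope ring_scope.

(** On forms phi, the total operator D = D_0 + D_1 + ... is
      D phi = d_A phi + (-1)^(|phi|+1) phi d + [t, phi],   d = d^0 + partial,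
    and coassociativity and cocommutativity of S[V] give
      D (D phi) = [curv, phi] - phi d d,   curv = D t + t /\ t.
    Since D is a differential on Sym_A(V, A), the right side vanishes there. On the constant
    forms, elements of A, the term phi d d vanishes, so curv = 0. Then phi d d = 0 for
    phi = alpha o pr_V with alpha in the A-dual of V, and injectivity of V into its double
    dual gives pr_V d d = 0. As d d is a coderivation and R contains the rationals, d d is
    determined by pr_V d d, hence vanishes. *)

(** * Linear and bilinear maps on tensor products *)

Section Bilinear.
Variables (R : comNzRingType).
Implicit Types (M N K L P Q : lmodType R).

Lemma linear_comp M N K (f : N -> K) (g : M -> N) :
  linear f -> linear g -> linear (fun x => f (g x)).
Proof. by move=> lf lg r x y /=; rewrite lg lf. Qed.

Lemma linear_add M N (f g : M -> N) :
  linear f -> linear g -> linear (fun x => f x + g x).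
Proof. by move=> lf lg r x y /=; rewrite lf lg scalerDr addrACA. Qed.

Lemma linear_scale M N (f : M -> N) c : linear f -> linear (fun x => c *: f x).
Proof. by move=> lf; apply: linear_comp => //; exact: scale_lin. Qed.

Lemma bilin_comp M N K P Q (B : M -> N -> K) (f : P -> M) (g : Q -> N) :
  bilin B -> linear f -> linear g -> bilin (fun a b => B (f a) (g b)).
Proof.
move=> [Bl Br] lf lg; split=> [y|x]; last exact: linear_comp.
exact: (linear_comp (Bl (g y))).
Qed.

Lemma bilin_post M N K L (B : M -> N -> K) (f : K -> L) :
  linear f -> bilin B -> bilin (fun a b => f (B a b)).
Proof. by move=> lf [Bl Br]; split=> [y|x]; exact: linear_comp. Qed.

Lemma bilin_add M N K (B B' : M -> N -> K) :
  bilin B -> bilin B' -> bilin (fun a b => B a b + B' a b).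
Proof. by move=> [Bl Br] [Bl' Br']; split=> [y|x]; exact: linear_add. Qed.

Lemma bilin_flip M N K (B : M -> N -> K) : bilin B -> bilin (fun b a => B a b).
Proof. by move=> [Bl Br]; split. Qed.

Lemma linear_tlift M N K L (f : L -> M -> N -> K) (z : tensor M N) :
  (forall a b, linear (fun x => f x a b)) -> (forall x, bilin (f x)) ->
  linear (fun x => tlift (f x) z).
Proof.
move=> lf bf r x y; elim/tensor_ind: z => [|c z z' IH IH'|a b]; last first.
- by rewrite !tlift_tens // lf.
- by rewrite !(tlift_linear (bf _)) IH IH' !scalerDr !scalerA [c * r]mulrC addrACA.
by rewrite !(lin0 (tlift_linear (bf _))) scaler0 addr0.
Qed.

Lemma tlift_add M N K (f g : M -> N -> K) z : bilin f -> bilin g ->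
  tlift (fun a b => f a b + g a b) z = tlift f z + tlift g z.
Proof.
move=> bf bg; have bfg := bilin_add bf bg.
elim/tensor_ind: z => [|c z z' IH IH'|a b]; last first.
- by rewrite !tlift_tens.
- rewrite (tlift_linear bf) (tlift_linear bg) (tlift_linear bfg) IH IH' !scalerDr.
  by rewrite addrACA.
by rewrite !(lin0 (tlift_linear _)) // addr0.
Qed.

Lemma tlift_post M N K L (f : M -> N -> K) (h : K -> L) z : linear h -> bilin f ->
  tlift (fun a b => h (f a b)) z = h (tlift f z).
Proof.
move=> lh bf; have bg := bilin_post lh bf.
elim/tensor_ind: z => [|c z z' IH IH'|a b]; last first.
- by rewrite !tlift_tens.
- by rewrite (tlift_linear bf) (tlift_linear bg) IH IH' lh.
by rewrite !(lin0 (tlift_linear _)) // (lin0 lh).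
Qed.

Lemma tlift_tmap M N P Q K (B : P -> Q -> K) (f : M -> P) (g : N -> Q) z :
  bilin B -> linear f -> linear g ->
  tlift B (tmap f g z) = tlift (fun a b => B (f a) (g b)) z.
Proof.
move=> bB lf lg; have bg := bilin_comp bB lf lg; have bt := tmap_linear lf lg.
elim/tensor_ind: z => [|c z z' IH IH'|a b]; last first.
- by rewrite tmapE // !tlift_tens.
- by rewrite bt (tlift_linear bB) (tlift_linear bg) IH IH'.
by rewrite (lin0 bt) !(lin0 (tlift_linear _)).
Qed.

Lemma tlift_id M N (z : tensor M N) : tlift (@tens R M N) z = z.
Proof.
have bt := tens_bilin M N; elim/tensor_ind: z => [|c z z' IH IH'|a b].
- exact: lin0 (tlift_linear bt).
- by rewrite (tlift_linear bt) IH IH'.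
exact: tlift_tens.
Qed.

End Bilinear.

(** * Reduction to homogeneous arguments and Koszul signs *)

Section Graded.
Variables (R : comNzRingType).

Lemma linear_hom_eq (M : gmodType R) (K : lmodType R) (f g : M -> K) :
  linear f -> linear g -> (forall p a, homog p a -> f a = g a) -> f = g.
Proof.
move=> lf lg fg; apply: funext => x; have [s _ ->] := gproj_sum x.
by rewrite !(lin_sum _ _ lf, lin_sum _ _ lg); apply: eq_bigr => n _;
  apply: (fg n); exact: homog_gproj.
Qed.

Lemma bilin_hom_eq (M N : gmodType R) (K : lmodType R) (f g : M -> N -> K) :
  bilin f -> bilin g ->
  (forall p q a b, homog p a -> homog q b -> f a b = g a b) -> f = g.
Proof.
move=> [fl fr] [gl gr] fg; apply: funext => a; apply: linear_hom_eq => // q b hb.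
suff : f^~ b = g^~ b by move/(congr1 (@^~ a)).
by apply: linear_hom_eq => // p c hc; exact: (fg p q).
Qed.

(** The definition of [cup] inserts degree-dependent signs through nested [hext]. This replaces the
    nest by one bilinear map [G] that already carries the signs, usually through [koszul]. *)
Lemma hext2_eq (M N : gmodType R) (K : lmodType R) (F : int -> int -> M -> N -> K)
    (G : M -> N -> K) :
  (forall p q, bilin (F p q)) -> bilin G ->
  (forall p q a b, homog p a -> homog q b -> F p q a b = G a b) ->
  (fun a b => hext (fun p a' => hext (fun q b' => F p q a' b') b) a) = G.
Proof.
move=> bF bG FG.
have b1 p : bilin (fun a b => hext (fun q b' => F p q a b') b).
  split=> [y|x]; first exact: (hext_arg_linear y (fun q => bilin_flip (bF p q))).
  by apply: hext_linear => q; case: (bF p q).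
apply: bilin_hom_eq => // [|p q a b ha hb].
  split=> [y|x]; last exact: hext_arg_linear.
  by apply: hext_linear => p; case: (b1 p).
rewrite (hext_homog _ ha) => [|r]; last by case: (b1 r).
by rewrite (hext_homog _ hb) => [|r]; [exact: FG|case: (bF p r)].
Qed.

Lemma homogZ (M : gmodType R) n c (x : M) : homog n x -> homog n (c *: x).
Proof. by move=> hx; rewrite -[_ *: x]addr0; apply: homog_lin => //; exact: homog0. Qed.

Lemma homogD (M : gmodType R) n (x y : M) : homog n x -> homog n y -> homog n (x + y).
Proof. by move=> hx hy; rewrite -[x]scale1r; apply: homog_lin. Qed.

Lemma is_hom_add (M N : gmodType R) n (f g : M -> N) :
  is_hom n f -> is_hom n g -> is_hom n (fun x => f x + g x).
Proof.
move=> [lf hf] [lg hg]; split=> [|p x hx]; first exact: linear_add.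
by apply: homogD; [exact: hf|exact: hg].
Qed.

Lemma homog_koszul (M : gmodType R) n p (x : M) : homog p x -> homog p (koszul n x).
Proof. by move=> hx; rewrite (koszul_homog _ hx); exact: homogZ. Qed.

Lemma koszul_comp (M : gmodType R) m n (x : M) : koszul m (koszul n x) = koszul (m + n) x.
Proof.
suff: (fun x => koszul m (koszul n x)) = @koszul R M (m + n) by move/(congr1 (@^~ x)).
apply: linear_hom_eq; [by apply: linear_comp; exact: koszul_linear|exact: koszul_linear|].
move=> p a ha; rewrite !(koszul_homog _ (homog_koszul _ ha)) !(koszul_homog _ ha).
by rewrite scalerA mulrDl ksignD.
Qed.

(** The degrees of [f x] and [x] differ by [m], which accounts for the extra sign. *)
Lemma koszul_hom (M N : gmodType R) m n (f : M -> N) x : is_hom m f ->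
  koszul n (f x) = ksign (n * m) *: f (koszul n x).
Proof.
move=> [lf hf].
suff: (fun x => koszul n (f x)) = (fun x => ksign (n * m) *: f (koszul n x)).
  by move/(congr1 (@^~ x)).
apply: linear_hom_eq => [||p a ha].
- by apply: linear_comp => //; exact: koszul_linear.
- by apply: linear_scale; apply: linear_comp => //; exact: koszul_linear.
rewrite (koszul_homog _ ha) (koszul_homog _ (hf _ _ ha)) (linZ _ _ lf) scalerA.
by rewrite mulrDr ksignD.
Qed.

Lemma koszul_even (M : gmodType R) n (x : M) : koszul (n + n) x = x.
Proof.
suff: @koszul R M (n + n) = id by move/(congr1 (@^~ x)).
apply: linear_hom_eq => [||p a ha]; [exact: koszul_linear|by []|].
by rewrite (koszul_homog _ ha) mulrDl ksignD ksignK scale1r.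
Qed.

End Graded.

(** * Sweedler sums over the diagonal *)

Section Sweedler.
Variables (R : comNzRingType) (V : gmodType R).
Implicit Types (K L : lmodType R).

(* In Sweedler notation, the sum of the B x_(1) x_(2). *)
Definition sweedler K (B : sym V -> sym V -> K) (x : sym V) : K := tlift B (diag x).

Lemma diag_linear : linear (@diag R V).
Proof. exact: slift_linear (wdiag_gsymm V). Qed.

Lemma sweedler_linear K (B : sym V -> sym V -> K) : bilin B -> linear (sweedler B).
Proof. by move=> bB; exact: linear_comp (tlift_linear bB) diag_linear. Qed.

Lemma sweedler_param K (L : lmodType R) (B : L -> sym V -> sym V -> K) x :
  (forall a b, linear (fun z => B z a b)) -> (forall z, bilin (B z)) ->
  linear (fun z => sweedler (B z) x).
Proof. exact: linear_tlift. Qed.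

End Sweedler.

(** Discharges the linearity side conditions of all Sweedler manipulations: it peels off the
    outermost operation and closes with linear or bilinear hypotheses in the context. *)
Ltac lin := cbv beta;
  first [ assumption | exact: id_linear |
  match goal with
  | |- forall _, _ => let x := fresh in intro x; lin
  | |- bilin _ => split; lin
  | |- GRing.linear_for _ (fun x => @?a x + @?b x) => apply: linear_add; lin
  | |- GRing.linear_for _ (fun x => _ *: _) => apply: linear_scale; lin
  | |- GRing.linear_for _ (fun x => sweedler _ _) =>
      first [apply: sweedler_param; lin | apply: (linear_comp (sweedler_linear _)); lin]
  | |- GRing.linear_for _ (sweedler _) => apply: sweedler_linear; lin
  | |- GRing.linear_for _ (fun x => smul _ _) =>
      first [apply: (linear_comp (@smul_linear _ _ _)); lin
            |apply: (linear_comp (@smul_linearl _ _ _)); lin]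
  | |- GRing.linear_for _ (@smul _ _ _) => exact: smul_linear
  | |- GRing.linear_for _ (fun x => koszul _ _) =>
      apply: (linear_comp (@koszul_linear _ _ _)); lin
  | |- GRing.linear_for _ (@koszul _ _ _) => exact: koszul_linear
  | H : bilin ?B |- GRing.linear_for _ (fun x => ?B _ ?y) =>
      apply: (linear_comp (proj1 H y)); lin
  | H : bilin ?B |- GRing.linear_for _ (fun x => ?B ?y _) =>
      apply: (linear_comp (proj2 H y)); lin
  | H : bilin ?B |- GRing.linear_for _ (?B ?y) => exact: (proj2 H y)
  | H : GRing.linear_for _ ?f |- GRing.linear_for _ (fun x => ?f _) =>
      apply: (linear_comp H); lin
  | H : forall _, bilin _ |- GRing.linear_for _ (fun x => _ _ ?y) =>
      apply: (linear_comp (proj1 (H _) y)); lin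
  | H : forall _, bilin _ |- GRing.linear_for _ (fun x => _ ?y _) =>
      apply: (linear_comp (proj2 (H _) y)); lin
  | H : forall _, bilin _ |- GRing.linear_for _ _ => exact: (proj2 (H _) _)
  | H : forall _ _, GRing.linear_for _ _ |- GRing.linear_for _ (fun x => _ _ ?y ?z) =>
      apply: (linear_comp (H y z)); lin
  end ].

(** * Coassociativity, cocommutativity and counit of S[V] *)

Section Coalgebra.
Variables (R : comNzRingType) (V : gmodType R).
Implicit Types (K L : lmodType R).

(** As v is primitive and the diagonal is multiplicative, the diagonal of v x is (v (x) 1 + 1 (x) v)
    times that of x; [koszul n] is the sign for moving v past the left factor. Inductions on the
    first letter rest on this recursion. *)
Lemma sweedler_smul K (B : sym V -> sym V -> K) n v x : homog n v -> bilin B ->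
  sweedler B (smul v x) =
  sweedler (fun a b => B (smul v a) b + B (koszul n a) (smul v b)) x.
Proof.
move=> hv bB; have bB' : bilin (fun a b => B (smul v a) b + B (koszul n a) (smul v b)) by lin.
rewrite /sweedler.
have -> : diag (smul v x) = dmul v (diag x).
  move: x; apply: sym_ind => [|r x y IHx IHy|w].
  - by rewrite (lin0 (smul_linear v)) !(lin0 (@diag_linear R V)) (lin0 ((dmul_bilin V).2 v)).
  - by rewrite (smul_linear v) !diag_linear ((dmul_bilin V).2 v) IHx IHy.
  by rewrite smul_word !diag_word.
rewrite /dmul (hext_homog _ hv); last by move=> p; exact: (smulr_bilin V p).1.
rewrite (linD _ _ (tlift_linear bB)) !tlift_tmap //; try lin.
by rewrite tlift_add //; lin.
Qed.

Lemma sweedler_one K (B : sym V -> sym V -> K) : bilin B ->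
  sweedler B (word [::]) = B (word [::]) (word [::]).
Proof. by move=> bB; rewrite /sweedler diag_word tlift_tens. Qed.

Lemma sym_smul_ind (Q : sym V -> Prop) :
  Q 0 -> (forall r x y, Q x -> Q y -> Q (r *: x + y)) -> Q (word [::]) ->
  (forall m n v x, homog m v -> homog n x -> Q x -> Q (smul v x)) -> forall x, Q x.
Proof.
move=> Q0 QD Q1 QM; apply: sym_hind => // n w; elim: w n => [|v w IH] //= n [p hv hw].
by rewrite -smul_word; apply: QM hv (homog_word hw) (IH _ hw).
Qed.

Lemma linear_smul_ind K (F G : sym V -> K) : linear F -> linear G ->
  F (word [::]) = G (word [::]) ->
  (forall m n v x, homog m v -> homog n x -> F x = G x -> F (smul v x) = G (smul v x)) ->
  F =1 G.
Proof.
move=> lF lG FG1 FGM; apply: sym_smul_ind => // [|r x y IHx IHy].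
  by rewrite (lin0 lF) (lin0 lG).
by rewrite lF lG IHx IHy.
Qed.

Lemma koszul_one n : koszul n (word [::] : sym V) = word [::].
Proof. by rewrite (koszul_homog _ (homog_word (n := 0) _)) // mulr0 scale1r. Qed.

Lemma koszul_smul n m (v : V) x : homog m v ->
  koszul n (smul v x) = ksign (n * m) *: smul v (koszul n x).
Proof.
by move=> hv; apply: koszul_hom; split=> [|p y hy]; [lin|exact: homog_smul].
Qed.

Definition trilin K (T : sym V -> sym V -> sym V -> K) : Prop :=
  (forall a, bilin (T a)) /\ (forall b c, linear (fun a => T a b c)).

Lemma sweedlerD K (f g : sym V -> sym V -> K) x : bilin f -> bilin g ->
  sweedler (fun a b => f a b + g a b) x = sweedler f x + sweedler g x.
Proof. exact: tlift_add. Qed.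

Lemma sweedler_post K L (h : K -> L) (f : sym V -> sym V -> K) x : linear h -> bilin f ->
  sweedler (fun a b => h (f a b)) x = h (sweedler f x).
Proof. exact: tlift_post. Qed.

Lemma sweedlerZ K (f : sym V -> sym V -> K) c x : bilin f ->
  sweedler (fun a b => c *: f a b) x = c *: sweedler f x.
Proof. by move=> bf; exact: tlift_post (scale_lin c) bf. Qed.

(** The diagonal preserves degree, so the sign of x is the product of the signs of its two factors.
    The form [B] varies in the induction because the recursion replaces it. *)
Lemma sweedler_koszul K (B : sym V -> sym V -> K) n x : bilin B ->
  sweedler B (koszul n x) = sweedler (fun a b => B (koszul n a) (koszul n b)) x.
Proof.
move=> bB; move: x K B bB; apply: sym_smul_ind => [|r x y IHx IHy||m p v x hv hx IH] K B bB.
- by rewrite (lin0 (@koszul_linear _ _ n)) !(lin0 (sweedler_linear _)) //; lin.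
- by rewrite (@koszul_linear _ _ n) !sweedler_linear ?IHx ?IHy //; lin.
- by rewrite koszul_one !sweedler_one ?koszul_one //; lin.
rewrite (koszul_smul n x hv) (linZ _ _ (sweedler_linear bB)) !(sweedler_smul _ hv); try lin.
rewrite IH; last lin.
rewrite -sweedlerZ; last lin.
congr sweedler; apply: funext => a; apply: funext => b.
rewrite !(koszul_smul _ _ hv) (linZ _ _ (bB.1 _)) (linZ _ _ (bB.2 _)) scalerDr.
by rewrite !koszul_comp addrC [m + n]addrC addrC.
Qed.

Lemma sweedlerA K (T : sym V -> sym V -> sym V -> K) x : trilin T ->
  sweedler (fun a b => sweedler (T a) b) x =
  sweedler (fun a c => sweedler (fun a1 a2 => T a1 a2 c) a) x.
Proof.
move: x T; apply: sym_smul_ind => [|r x y IHx IHy||m n v x hv hx IH] T [T1 T2].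
- by rewrite !(lin0 (sweedler_linear _)) //; lin.
- by rewrite !sweedler_linear ?IHx ?IHy //; lin.
- by rewrite !sweedler_one //; lin.
rewrite !(sweedler_smul _ hv); try lin.
(* The new letter [v] lands in one of three tensor slots, with the sign of the factors it passes.
   Both bracketings of the iterated diagonal lead to this [T']. *)
pose T' a b c := T (smul v a) b c +
  (T (koszul m a) (smul v b) c + T (koszul m a) (koszul m b) (smul v c)).
transitivity (sweedler (fun a b => sweedler (T' a) b) x).
  congr sweedler; apply: funext => a; apply: funext => b.
  by rewrite (sweedler_smul _ hv) -?sweedlerD //; lin.
rewrite IH; last by split=> [a|b c]; rewrite /T'; lin.
congr sweedler; apply: funext => a; apply: funext => c.
(* Here the sign sits on [a] before [a] is split, and has to be distributed over [a1] and [a2]. *)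
rewrite (sweedler_smul _ hv) ?sweedler_koszul -?sweedlerD //; try lin.
by congr sweedler; apply: funext => a1; apply: funext => a2; rewrite /T' addrA.
Qed.

(* (-1)^(|a||b|) B b a *)
Definition swap K (B : sym V -> sym V -> K) (a b : sym V) : K :=
  hext (fun p a' => B (koszul p b) a') a.

Lemma swap_bilin K (B : sym V -> sym V -> K) : bilin B -> bilin (swap B).
Proof.
move=> bB; split=> [b|a]; first by apply: hext_linear => p; lin.
by apply: hext_arg_linear => p; lin.
Qed.

Lemma swap_homog K (B : sym V -> sym V -> K) p a b : bilin B -> homog p a ->
  swap B a b = B (koszul p b) a.
Proof. by move=> bB ha; rewrite /swap (hext_homog _ ha) // => q; lin. Qed.

(** The swap exchanges the two summands of the recursion: v in the left factor becomes v in the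
    right one, and the signs produced by v cancel in pairs. *)
Lemma sweedlerC K (B : sym V -> sym V -> K) x : bilin B ->
  sweedler B x = sweedler (swap B) x.
Proof.
move: x B; apply: sym_smul_ind => [|r x y IHx IHy||m n v x hv hx IH] B bB;
  have bS := swap_bilin bB.
- by rewrite !(lin0 (sweedler_linear _)).
- by rewrite (sweedler_linear bB) (sweedler_linear bS) IHx // IHy.
- by rewrite !sweedler_one // (swap_homog _ bB (homog_word (n := 0) _)) // koszul_one.
rewrite !(sweedler_smul _ hv) // IH; last lin.
congr sweedler; apply: bilin_hom_eq => [||p q a b ha hb]; last first.
- rewrite (swap_homog _ _ ha) ?(swap_homog _ _ (homog_koszul _ ha)) //; last lin.
  rewrite (swap_homog _ _ (homog_smul hv ha)) // (koszul_smul _ _ hv).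
  rewrite (koszul_homog _ ha) (linZ _ _ (bB.1 _)) (linZ _ _ (bB.2 _)) scalerA [p * m]mulrC.
  by rewrite ksignK scale1r koszul_comp addrC.
- by lin.
by apply: swap_bilin; lin.
Qed.

Lemma linear_scalel (M K : lmodType R) (f : M -> R^o) (v : K) :
  linear f -> linear (fun a => (f a : R) *: v).
Proof. by move=> lf r a b /=; rewrite lf scalerDl scalerA. Qed.

Lemma counit_linear : linear (@counit R V : sym V -> R^o).
Proof. exact: slift_linear (counit_gsymm V). Qed.

Lemma counit_one : counit (word [::] : sym V) = 1.
Proof. exact: (slift_word _ (counit_gsymm V)). Qed.

Lemma counit_smul (v : V) x : counit (smul v x) = 0.
Proof.
move: x; apply: sym_ind => [|r x y IHx IHy|w].
- by rewrite (lin0 (smul_linear v)); exact: (lin0 counit_linear).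
- by rewrite (smul_linear v) counit_linear IHx IHy scaler0 addr0.
by rewrite smul_word; exact: (slift_word _ (counit_gsymm V)).
Qed.

Lemma counit_gproj n (x : sym V) : counit (gproj n x) = if n == 0 then counit x else 0.
Proof.
move: x; apply: sym_smul_ind => [|r x y IHx IHy||m p v x hv hx IH].
- by rewrite gproj0 (lin0 counit_linear) if_same.
- rewrite gproj_linear !counit_linear IHx IHy; case: ifP => // _.
  by rewrite scaler0 addr0.
- rewrite (gproj_homog _ (homog_word (n := 0) _)) //; case: ifP => // _.
  exact: (lin0 counit_linear).
by rewrite (gproj_smul _ _ hv) !counit_smul if_same.
Qed.

Lemma counit_koszul n (x : sym V) : counit (koszul n x) = counit x.
Proof.
move: x; apply: (@linear_smul_ind R^o) => [|||m p v x hv hx IH].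
- exact: (linear_comp counit_linear (@koszul_linear _ _ n)).
- exact: counit_linear.
- by rewrite koszul_one.
by rewrite (koszul_smul _ _ hv) (linZ _ _ counit_linear) !counit_smul scaler0.
Qed.

Lemma counitl_bilin : bilin (fun a b : sym V => counit a *: b).
Proof. by split=> [b|a]; [exact: linear_scalel counit_linear|lin]. Qed.

Lemma counitr_bilin : bilin (fun a b : sym V => counit b *: a).
Proof. by split=> [a|b]; [lin|exact: linear_scalel counit_linear]. Qed.

(** The counit kills every product v a, so only the summand with v in the right factor survives in
    the recursion. *)
Lemma sweedler_counitl x : sweedler (fun a b : sym V => counit a *: b) x = x.
Proof.
have bC := counitl_bilin.
move: x; apply: linear_smul_ind => [|||m p v x hv hx IH]; [lin|lin| |].
  by rewrite sweedler_one // counit_one scale1r.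
rewrite (sweedler_smul _ hv) // -[in RHS]IH -(sweedler_post x (smul_linear v)) //.
congr sweedler; apply: funext => a; apply: funext => b.
by rewrite counit_smul counit_koszul scale0r add0r (linZ _ _ (smul_linear _)).
Qed.

Lemma sweedler_counitr x : sweedler (fun a b : sym V => counit b *: a) x = x.
Proof.
have bC := counitr_bilin.
move: x; apply: linear_smul_ind => [|||m p v x hv hx IH]; [lin|lin| |].
  by rewrite sweedler_one // counit_one scale1r.
rewrite (sweedler_smul _ hv) // -[in RHS]IH -(sweedler_post x (smul_linear v)) //.
congr sweedler; apply: funext => a; apply: funext => b.
by rewrite counit_smul scale0r addr0 (linZ _ _ (smul_linear _)).
Qed.

End Coalgebra.

(** * Coderivations and their squares *)

Section CoderivationTheory.
Variables (R : comNzRingType) (V : gmodType R).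
Implicit Types (K : lmodType R) (f g d : sym V -> sym V).

Lemma coderivation_sweedler K (B : sym V -> sym V -> K) n f x :
  coderivation n f -> bilin B ->
  sweedler B (f x) = sweedler (fun a b => B (f a) b + B (koszul n a) (f b)) x.
Proof.
move=> [[lf _] df] bB; rewrite {1}/sweedler df (linD _ _ (tlift_linear bB)).
rewrite !tlift_tmap //; try lin.
by rewrite sweedlerD //; lin.
Qed.

(** Testing against the universal bilinear map [tens] recovers the identity in the tensor square. *)
Lemma sweedler_coderivation n f : is_hom n f ->
  (forall K (B : sym V -> sym V -> K) x, bilin B ->
     sweedler B (f x) = sweedler (fun a b => B (f a) b + B (koszul n a) (f b)) x) ->
  coderivation n f.
Proof.
move=> hf df; split=> // x; have lf := hf.1.
have bt := tens_bilin (sym V) (sym V).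
rewrite -[LHS]tlift_id -[tlift _ _]/(sweedler _ _) df // sweedlerD //; lin.
Qed.

Lemma coderivation_add n f g : coderivation n f -> coderivation n g ->
  coderivation n (fun x => f x + g x).
Proof.
move=> cf cg; apply: sweedler_coderivation => [|K B x bB].
  by apply: is_hom_add; [case: cf|case: cg].
have [[lf _] _] := cf; have [[lg _] _] := cg.
rewrite (linD _ _ (sweedler_linear bB)) (coderivation_sweedler x cf bB).
rewrite (coderivation_sweedler x cg bB) -sweedlerD; try lin.
congr sweedler; apply: funext => a; apply: funext => b.
by rewrite (linD _ _ (bB.1 _)) (linD _ _ (bB.2 _)) addrACA.
Qed.

(** The mixed terms in d a and d b cancel: d is odd, so moving [koszul (-1)] past it changes the
    sign. Hence d d obeys the coderivation rule of even degree, without signs. *)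
Lemma coderivation_square K (B : sym V -> sym V -> K) d x :
  coderivation (-1) d -> bilin B ->
  sweedler B (d (d x)) = sweedler (fun a b => B (d (d a)) b + B a (d (d b))) x.
Proof.
move=> cd bB; have [[ld _] _] := cd.
rewrite !(coderivation_sweedler _ cd); try lin.
congr sweedler; apply: funext => a; apply: funext => b.
rewrite (koszul_hom _ a cd.1) koszul_comp koszul_even (linZ _ _ (bB.1 _)) /ksign expr1 scaleN1r.
by rewrite addrA addrNK.
Qed.

End CoderivationTheory.

(** * The induced differential d^0 as a coderivation *)

Section SymDifferential.
Variables (R : comNzRingType) (V : dgmodType R).

Lemma sdiff_linear : linear (@sdiff R V).
Proof. exact: slift_linear (wdiff_gsymm V). Qed.

Lemma sdiff_one : sdiff (word [::] : sym V) = 0.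
Proof. by rewrite sdiff_word. Qed.

Lemma sdiff_smul n (v : V) x : homog n v ->
  sdiff (smul v x) = smul (gdiff v) x + ksign n *: smul v (sdiff x).
Proof.
move=> hv; have ls := sdiff_linear; pose F x := sdiff (smul v x).
suff: F =1 (fun x => smul (gdiff v) x + ksign n *: smul v (sdiff x)) by apply.
have lF : linear F by rewrite /F; lin.
have lG : linear (fun x => smul (gdiff v) x + ksign n *: smul v (sdiff x)) by lin.
apply: sym_ind => [|r y z IHy IHz|w]; first by rewrite (lin0 lF) (lin0 lG).
  by rewrite lF lG IHy IHz.
rewrite /F !smul_word !sdiff_word /= (hext_homog _ hv) // => p; lin.
Qed.

Lemma sdiff_hom : is_hom (-1) (@sdiff R V).
Proof.
have ls := sdiff_linear; split=> // p x hx.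
(* Commuting with all projections is a condition linear in [y] and makes sense for inhomogeneous
   [y], so it suits the induction. *)
pose Q (y : sym V) := forall q, gproj (-1 + q) (sdiff y) = sdiff (gproj q y).
suff H y : Q y by rewrite /homog H hx.
move: y; apply: sym_smul_ind => [|r y z IHy IHz|q|m n v y hv hy IH q].
- by move=> q; rewrite gproj0 (lin0 ls) gproj0.
- by move=> q; rewrite ls !gproj_linear ls IHy IHz.
- rewrite sdiff_one gproj0 (gproj_homog _ (homog_word (n := 0) _)) //.
  by case: ifP; rewrite ?sdiff_one ?(lin0 ls).
rewrite (sdiff_smul _ hv) (gproj_smul _ _ hv) (sdiff_smul _ hv).
rewrite (linD _ _ (gproj_linear _)) (linZ _ _ (gproj_linear _)).
rewrite (gproj_smul _ _ (gdiff_homog _ _ hv)) (gproj_smul _ _ hv).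
have -> : -1 + q - (m - 1) = q - m by lia.
by rewrite -[-1 + q - m]addrA IH.
Qed.

(** Induction on the first letter: d^0 is a derivation of the product, and both v and dv are
    primitive, so the two recursions match term by term. *)
Lemma sdiff_coderivation : coderivation (-1) (@sdiff R V).
Proof.
have ls := sdiff_linear; have hs := sdiff_hom.
apply: sweedler_coderivation => // K B x bB.
move: x K B bB; apply: sym_smul_ind => [|r x y IHx IHy||m n v x hv hx IH] K B bB.
- by rewrite (lin0 ls) !(lin0 (sweedler_linear _)) //; lin.
- by rewrite ls !sweedler_linear ?IHx ?IHy //; lin.
- rewrite sdiff_one (lin0 (sweedler_linear bB)) sweedler_one; last lin.
  by rewrite sdiff_one (lin0 (bB.1 _)) (lin0 (bB.2 _)) addr0.
rewrite (sdiff_smul _ hv) (linD _ _ (sweedler_linear bB)) (linZ _ _ (sweedler_linear bB)).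
rewrite (sweedler_smul _ hv) // (sweedler_smul _ (gdiff_homog _ _ hv)) // IH; last lin.
rewrite (sweedler_smul _ hv); last lin.
rewrite -sweedlerZ -?sweedlerD; try lin.
congr sweedler; apply: funext => a; apply: funext => b.
rewrite !(sdiff_smul _ hv) (koszul_smul _ _ hv) (koszul_hom _ _ hs).
rewrite !(linD _ _ (bB.1 _)) !(linD _ _ (bB.2 _)) !(linZ _ _ (bB.1 _)) !(linZ _ _ (bB.2 _)).
rewrite !koszul_comp mulrN1 mulN1r !ksignN !scalerDr !scalerA ksignK scale1r.
rewrite [-1 + m]addrC.
rewrite -!addrA; congr (_ + _); rewrite [LHS]addrCA; congr (_ + _).
by rewrite [LHS]addrCA [RHS]addrCA; congr (_ + _); exact: addrCA.
Qed.

End SymDifferential.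

(** * Projection to V, Euler operator and uniqueness of coderivations *)

Section Cogenerators.
Variables (R : comNzRingType) (V : gmodType R).

(** The projection pr_V of S[V] onto S^1[V] = V. *)
Definition sym_linear_part : sym V -> V := slift (fun w => if w is [:: v] then v else 0).

Lemma linear_part_gsymm : gsymm (fun w : seq V => if w is [:: v] then v else 0).
Proof.
split=> [[|a [|a' s1]] [|b s2] r u v|[|a [|a' s1]] s2 m n u v hu hv] //=;
  by rewrite ?scaler0 ?addr0.
Qed.

Lemma linear_part_linear : linear sym_linear_part.
Proof. exact: slift_linear linear_part_gsymm. Qed.

Lemma linear_part_word w : sym_linear_part (word w) = if w is [:: v] then v else 0.
Proof. exact: slift_word linear_part_gsymm. Qed.

Lemma linear_part_smul v x : sym_linear_part (smul v x) = counit x *: v.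
Proof.
have lp := linear_part_linear.
have lG := linear_scalel v (@counit_linear R V).
move: x; apply: sym_ind => [|r x y IHx IHy|w].
- by rewrite (lin0 (smul_linear v)) (lin0 lp) (lin0 lG).
- by rewrite (smul_linear v) lp lG IHx IHy.
rewrite smul_word linear_part_word /counit (slift_word _ (counit_gsymm V)).
by case: w; rewrite ?scale1r ?scale0r.
Qed.

Lemma linear_part_hom : is_hom 0 sym_linear_part.
Proof.
have lp := linear_part_linear; split=> // p x hx; rewrite add0r.
suff H y : gproj p (sym_linear_part y) = sym_linear_part (gproj p y) by rewrite /homog H hx.
have lg := @gproj_linear R V p; have lg' := @gproj_linear R (sym V) p.
move: y; apply: linear_smul_ind => [|||m n v y hv hy IH]; [lin|lin| |].
  rewrite linear_part_word gproj0 (gproj_homog _ (homog_word (n := 0) _)) //.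
  by case: ifP; rewrite ?linear_part_word ?(lin0 lp).
rewrite (gproj_smul _ _ hv) !linear_part_smul (linZ _ _ lg) (gproj_homog _ hv).
by rewrite counit_gproj subr_eq0; case: ifP; rewrite ?scaler0 ?scale0r.
Qed.

(* Multiplication after (pr_V (x) 1) o Delta scales S^k[V] by k. *)
Definition euler : sym V -> sym V :=
  sweedler (fun a b => smul (sym_linear_part a) b).

Lemma euler_bilin : bilin (fun a b : sym V => smul (sym_linear_part a) b).
Proof. by have lp := linear_part_linear; lin. Qed.

(** Either v itself is split off, and the counit law returns v x, or v stays in the right factor;
    moving it back past the split-off letter then cancels the Koszul sign. *)
Lemma euler_smul n v x : homog n v -> euler (smul v x) = smul v x + smul v (euler x).
Proof.
move=> hv; have bE := euler_bilin; have lp := linear_part_linear.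
rewrite /euler (sweedler_smul _ hv) // -[X in smul v X + _]sweedler_counitl.
have bC := @counitl_bilin R V.
have bC' := bilin_post (smul_linear v) bC; have bE' := bilin_post (smul_linear v) bE.
rewrite -!(sweedler_post x (smul_linear v)) // -sweedlerD //.
congr sweedler; apply: bilin_hom_eq => [||p q a b ha hb]; [lin|exact: bilin_add|].
rewrite linear_part_smul (linZ _ _ (smul_linear v)) (linZ _ _ (smul_linearl b)); congr (_ + _).
rewrite (koszul_homog _ ha) (linZ _ _ lp) (linZ _ _ (smul_linearl _)).
have := linear_part_hom.2 _ _ ha; rewrite add0r => ha'.
by rewrite (smulC b hv ha').
Qed.

Lemma euler_word w : euler (word w) = (size w)%:R *: word w.
Proof.
have lE : linear euler by apply: sweedler_linear; exact: euler_bilin.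
(* The letters of [w] need not be homogeneous. Extending the right side linearly to S[V] allows the
   induction to run over homogeneous words only. *)
pose wlen : sym V -> sym V := slift (fun w => (size w)%:R *: word w).
have gw : gsymm (fun w : seq V => (size w)%:R *: word w).
  split=> [s1 s2 r u v|s1 s2 m n u v hu hv].
    by rewrite (@word_gsymm R V).1 !size_cat scalerDr !scalerA mulrC.
  by rewrite ((@word_gsymm R V).2 _ _ _ _ _ _ hu hv) !size_cat !scalerA mulrC.
suff E : euler =1 wlen by rewrite E /wlen (slift_word _ gw).
have lw : linear wlen by exact: slift_linear.
apply: sym_hind => [|r x y IHx IHy|n u]; first by rewrite (lin0 lE) (lin0 lw).
  by rewrite lE lw IHx IHy.
rewrite /wlen (slift_word _ gw); elim: u n => [|v u IH] n /=.
  move=> _; rewrite /euler sweedler_one; last exact: euler_bilin.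
  by rewrite linear_part_word (lin0 (smul_linearl _)) scale0r.
move=> [p hv hu]; rewrite -smul_word (euler_smul _ hv) (IH _ hu).
by rewrite (linZ _ _ (smul_linear v)) -[X in X + _]scale1r -scalerDl nat1r.
Qed.

Definition sym_part (k : nat) : sym V -> sym V :=
  slift (fun w => if size w == k then word w else 0).

Lemma sym_part_gsymm k : gsymm (fun w : seq V => if size w == k then word w else 0).
Proof.
split=> [s1 s2 r u v|s1 s2 m n u v hu hv]; rewrite !size_cat /=; case: ifP => _.
- exact: (@word_gsymm R V).1.
- by rewrite scaler0 addr0.
- exact: (@word_gsymm R V).2.
by rewrite scaler0.
Qed.

Lemma sym_part_linear k : linear (sym_part k).
Proof. exact: slift_linear (sym_part_gsymm k). Qed.

Lemma sym_part_word k w : sym_part k (word w) = if size w == k then word w else 0.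
Proof. exact: slift_word (sym_part_gsymm k). Qed.

Lemma sym_part_euler k x : sym_part k (euler x) = k%:R *: sym_part k x.
Proof.
have lE : linear euler by apply: sweedler_linear; exact: euler_bilin.
have lk := sym_part_linear k; have lF : linear (fun x => sym_part k (euler x)) by lin.
have lG : linear (fun x => k%:R *: sym_part k x) by lin.
move: x; apply: sym_ind => [|r x y IHx IHy|w]; first by rewrite (lin0 lF) (lin0 lG).
  by rewrite lF lG IHx IHy.
rewrite euler_word (linZ _ _ lk) sym_part_word.
by case: eqP => [->|]; rewrite ?scaler0.
Qed.

Lemma sym_part0 x : sym_part 0 x = counit x *: word [::].
Proof.
have lk := sym_part_linear 0; have lG := linear_scalel (word [::] : sym V) (@counit_linear R V).
move: x; apply: sym_ind => [|r x y IHx IHy|w]; first by rewrite (lin0 lk) (lin0 lG).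
  by rewrite lk lG IHx IHy.
rewrite sym_part_word /counit (slift_word _ (counit_gsymm V)).
by case: w; rewrite ?scale1r ?scale0r.
Qed.

Lemma sym_part_eq0 x : (forall k, sym_part k x = 0) -> x = 0.
Proof.
move=> x0; suff [n ->] : exists n, x = \sum_(k < n) sym_part k x.
  by rewrite big1 // => k _.
(* Requiring the equation for every [m] beyond [n] lets two bounds be merged by their maximum. *)
suff [n /(_ n (leqnn n))] : exists n, forall m, (n <= m)%N -> x = \sum_(k < m) sym_part k x.
  by exists n.
move: (x); apply: sym_ind => [|r y z [m Hm] [n Hn]|w].
- by exists 0%N => m _; rewrite big1 // => k _; exact: (lin0 (sym_part_linear k)).
- exists (maxn m n) => p; rewrite geq_max => /andP[/Hm yp /Hn zp].
  under eq_bigr do rewrite sym_part_linear.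
  by rewrite big_split -scaler_sumr /= -yp -zp.
exists (size w).+1 => m wm; under eq_bigr do rewrite sym_part_word.
rewrite (bigD1 (Ordinal wm)) //= eqxx big1 ?addr0 // => k.
by rewrite -val_eqE /= eq_sym => /negPf ->.
Qed.

(* In (pr_V (x) F) o Delta on a word of length k+1, F is only evaluated on subwords of
   length k. *)
Lemma sweedler_linear_part (L : V -> V) (F : sym V -> sym V) n w :
  linear L -> linear F -> hword n w ->
  (forall m u, hword m u -> (size u < size w)%N -> F (word u) = 0) ->
  sweedler (fun a b => smul (L (sym_linear_part a)) (F b)) (word w) = 0.
Proof.
have lp := linear_part_linear.
(* [L] and [F] vary because passing the first letter [v] composes them with [koszul p] and with
   multiplication by [v]. *)
elim: w n L F => [|v w IH] n L F lL lF.
  move=> _ _; rewrite sweedler_one; last lin.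
  by rewrite linear_part_word (lin0 lL) (lin0 (smul_linearl _)).
move=> /= [p hv hw] F0; rewrite -smul_word (sweedler_smul _ hv); last lin.
rewrite sweedlerD; try lin.
have -> : (fun a b : sym V => smul (L (sym_linear_part (smul v a))) (F b)) =
    (fun a b => smul (L v) (F (counit a *: b))).
  apply: funext => a; apply: funext => b.
  rewrite linear_part_smul (linZ _ _ lL) (linZ _ _ (smul_linearl _)).
  by rewrite (linZ _ _ lF) (linZ _ _ (smul_linear _)).
(* Where [v] is split off, the counit collapses the sum to [F] on the shorter word [w]. *)
rewrite (sweedler_post (h := fun y => smul (L v) (F y))); [|lin|exact: counitl_bilin].
rewrite sweedler_counitl (F0 _ _ hw) // (lin0 (smul_linear _)) add0r.
have -> : (fun a b : sym V => smul (L (sym_linear_part (koszul p a))) (F (smul v b))) =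
    (fun a b => smul (L (koszul p (sym_linear_part a))) (F (smul v b))).
  apply: funext => a; apply: funext => b.
  by rewrite (koszul_hom _ _ linear_part_hom) mulr0 scale1r.
apply: (IH (n - p) (fun y => L (koszul p y)) (fun y => F (smul v y))) => //; try lin.
move=> m u hu uw; rewrite smul_word; apply: (F0 (m + p)) => //=.
by exists p => //; rewrite addrK.
Qed.

(** Applying the counit to both tensor factors of the coderivation identity gives e f = e f + e f
    for the counit e. The computation takes place in S[V], where [sym_part 0] is the counit followed
    by the unit. *)
Lemma coderivation_counit n (f : sym V -> sym V) x : coderivation n f -> counit (f x) = 0.
Proof.
move=> cf; have [[lf _] _] := cf.
have l0 := sym_part_linear 0; have bC := @counitr_bilin R V; have bC' := @counitl_bilin R V.
have l0f : linear (fun y => sym_part 0 (f y)) by lin.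
suff part0 : sym_part 0 (f x) = 0.
  have := congr1 (@counit R V) part0; rewrite sym_part0 (linZ _ _ (@counit_linear R V)).
  by rewrite counit_one (lin0 (@counit_linear R V)) [_ *: _]mulr1.
have bB : bilin (fun a b : sym V => counit b *: sym_part 0 a).
  by split=> [b|a]; [lin|exact: (linear_scalel _ (@counit_linear R V))].
have := coderivation_sweedler x cf bB.
rewrite sweedlerD; [|exact: (bilin_comp bB lf (@id_linear _ _))|
  exact: (bilin_comp bB (@koszul_linear R _ n) lf)].
have -> : (fun a b : sym V => counit b *: sym_part 0 a) =
    (fun a b => sym_part 0 (counit b *: a)).
  by apply: funext => a; apply: funext => b; rewrite (linZ _ _ l0).
have -> : (fun a b : sym V => counit b *: sym_part 0 (f a)) =
    (fun a b => sym_part 0 (f (counit b *: a))).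
  by apply: funext => a; apply: funext => b; rewrite (linZ _ _ l0f).
have -> : (fun a b : sym V => counit (f b) *: sym_part 0 (koszul n a)) =
    (fun a b => sym_part 0 (f (counit a *: b))).
  apply: funext => a; apply: funext => b.
  by rewrite (linZ _ _ l0f) !sym_part0 counit_koszul !scalerA mulrC.
rewrite (sweedler_post _ l0) // !(sweedler_post _ l0f) //.
rewrite !sweedler_counitr sweedler_counitl.
by rewrite -[LHS]addr0 => /addrI.
Qed.

(* The Euler operator of S[V] kills F on a word as soon as F vanishes on shorter words;
   the rationals then give F = 0 on each S^k[V] with k >= 1. *)
Lemma even_coderivation_eq0 (iota : {rmorphism rat -> R}) (F : sym V -> sym V) :
  linear F ->
  (forall (K : lmodType R) (B : sym V -> sym V -> K) x, bilin B ->
     sweedler B (F x) = sweedler (fun a b => B (F a) b + B a (F b)) x) ->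
  (forall x, counit (F x) = 0) -> (forall x, sym_linear_part (F x) = 0) ->
  forall x, F x = 0.
Proof.
move=> lF dF eF pF; have lp := linear_part_linear.
have word0 m : forall n w, hword n w -> (size w < m)%N -> F (word w) = 0.
  elim: m => // m IH n w hw; rewrite ltnS => wm.
  (* The Euler eigenvalue on S^0[V] is 0 and cannot be inverted; that component vanishes by the
     counit hypothesis. *)
  apply: sym_part_eq0 => -[|k]; first by rewrite sym_part0 eF scale0r.
  have eF0 : euler (F (word w)) = 0.
    rewrite /euler dF; last exact: euler_bilin.
    rewrite sweedlerD; try lin.
    (* The half with [F] on the right vanishes by induction on length, the half with [F] on the left
       because pr_V F = 0. *)
    rewrite (@sweedler_linear_part id F n) // => [|p u hu uw]; last first.
      exact: (IH p) hu (leq_trans uw wm).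
    rewrite addr0; have bE := euler_bilin.
    have -> : (fun a b : sym V => smul (sym_linear_part (F a)) b) =
        (fun a b => 0 *: smul (sym_linear_part a) b).
      apply: funext => a; apply: funext => b.
      by rewrite pF (lin0 (smul_linearl _)) scale0r.
    by rewrite sweedlerZ // scale0r.
  have := sym_part_euler k.+1 (F (word w)).
  rewrite eF0 (lin0 (sym_part_linear _)) => /(congr1 (fun y => iota (k.+1%:R^-1) *: y)).
  rewrite scaler0 scalerA -(rmorph_nat iota) -rmorphM mulVf ?Num.Theory.pnatr_eq0 //.
  by rewrite rmorph1 scale1r => <-.
move=> x; elim/sym_hind: x => [|r x y Fx Fy|n w hw]; first exact: lin0 lF.
  by rewrite lF Fx Fy scaler0 addr0.
exact: (word0 (size w).+1 n).
Qed.
End Cogenerators.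

(** * The total operator and its square *)

Section TwistedDifferential.
Variables (R : comNzRingType) (A : dgcalgType R) (V : gmodType R).
Implicit Types (t : sym V -> A -> A) (phi : sym V -> A).

(** Values of [t] are known to be derivations only at homogeneous elements; linearity in the second
    argument extends to all of S[V] by decomposition. *)
Lemma der_hom_bilin n t : der_hom n t -> bilin t.
Proof.
move=> [lt ht]; split=> [c r x y|x r c c']; first by rewrite lt.
have lc b : linear (fun x => t x b) by move=> s y z; rewrite lt.
suff: (fun x => t x (r *: c + c')) = (fun x => r *: t x c + t x c').
  by move/(congr1 (@^~ x)).
apply: linear_hom_eq => [||p a ha]; [exact: lc|exact: linear_add (linear_scale r (lc c)) (lc c')|].
by have [[l _] _] := ht _ _ ha; rewrite l.
Qed.

Lemma der_of_morphismE t n phi x : bilin t -> linear phi ->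
  der_of_morphism t n phi x = sweedler (fun a b => t (koszul n a) (phi b)) x.
Proof.
move=> bt lp; congr (tlift _ _).
apply: (hext2_eq (F := fun p q a b => ksign (n * p) *: t a (phi b))).
- by move=> p q; lin.
- by lin.
by move=> p q a b ha hb; rewrite (koszul_homog _ ha) (linZ _ _ (bt.1 _)).
Qed.

Lemma bilin_eval (M N : lmodType R) (B : M -> N -> A -> A) :
  (forall c, bilin (fun a b => B a b c)) -> bilin B.
Proof.
move=> bB; split=> [b|a] r u v; apply: funext => c.
  exact: (bB c).1.
exact: (bB c).2.
Qed.

(* The integrand of t /\ t: by cocommutativity both halves of the bracket in
   1/2 [t, t] contribute the same. *)
Definition compose2 t (a b : sym V) : A -> A := fun c => t (koszul (-1) a) (t b c).

Lemma compose2_bilin t : bilin t -> bilin (compose2 t).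
Proof.
move=> bt; split=> [b|a] r x y; apply: funext => c; rewrite /compose2.
  by rewrite (@koszul_linear R _ (-1)) bt.1.
by rewrite bt.1 bt.2.
Qed.

Lemma der_bracket_cup t x : bilin t ->
  cup (@der_bracket R A) (-1) t (-1) t x = sweedler (compose2 t) x *+ 2.
Proof.
move=> bt; have bc := compose2_bilin bt; have bs := swap_bilin bc.
(* One of the two equal copies is swapped, so that the sum becomes the graded commutator. *)
rewrite mulr2n {2}sweedlerC // -sweedlerD // /cup /sweedler; congr (tlift _ _).
apply: (hext2_eq (F := fun p q a b =>
  ksign (-1 * p) *: @der_bracket R A (-1 + p) (-1 + q) (t a) (t b))).
- move=> p q; apply: bilin_eval => c.
  rewrite [X in bilin X](_ : _ = fun a b => ksign (-1 * p) *:
    (t a (t b c) + - ksign ((-1 + p) * (-1 + q)) *: t b (t a c))); first lin.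
  by apply: funext => a; apply: funext => b; rewrite scaleNr.
- exact: bilin_add.
move=> p q a b ha hb; rewrite (swap_homog _ bc ha); apply: funext => c.
rewrite -[LHS]/(_ *: (_ - _)) -[RHS]/(_ + _) /compose2 koszul_comp.
rewrite (koszul_homog _ ha) (koszul_homog _ hb) !(linZ _ _ (bt.1 _)).
rewrite scalerBr; congr (_ + _); rewrite scalerA -scaleNr; congr (_ *: _).
rewrite -ksignD -mulrN1 -[X in _ * X]/(ksign 1) -ksignD.
(* The two sign exponents differ by the even integer 2(1 - p). *)
have -> : -1 * p + (-1 + p) * (-1 + q) + 1 = (-1 + p) * q + ((1 - p) + (1 - p)) by ring.
by rewrite [LHS]ksignD ksignD ksignK mulr1.
Qed.

Lemma sweedler_eval (B : sym V -> sym V -> A -> A) x c : bilin B ->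
  sweedler B x c = sweedler (fun a b => B a b c) x.
Proof. by move=> bB; rewrite (sweedler_post (h := fun f : A -> A => f c)). Qed.

(* D_0 + sum_j D_j, when d is d^0 plus the coderivation *)
Definition twist_diff (d : sym V -> sym V) t (n : int) phi (x : sym V) : A :=
  gdiff (phi x) + ksign (n + 1) *: phi (d x) +
  sweedler (fun a b => t (koszul n a) (phi b)) x.

(* D t + t /\ t, with the signs (-1)^|x| absorbed by koszul *)
Definition curvature (d : sym V -> sym V) t (x : sym V) (c : A) : A :=
  gdiff (t x c) + t (koszul (-1) x) (gdiff c) + t (d x) c +
  sweedler (fun a b => t (koszul (-1) a) (t b c)) x.

Lemma curvature_bilin d t : linear d -> bilin t -> bilin (curvature d t).
Proof.
move=> ld bt; have lg := @gdiff_linear R A.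
by rewrite /curvature; lin.
Qed.

(** This is D (D phi) = [curv, phi] - phi d d. It needs neither d d = 0 nor any condition of
    A-multilinearity on phi. *)
Lemma twist_diff_square d t n phi x :
  coderivation (-1) d -> bilin t -> linear phi ->
  twist_diff d t (n - 1) (twist_diff d t n phi) x =
  sweedler (fun a b => curvature d t (koszul n a) (phi b)) x - phi (d (d x)).
Proof.
move=> cd bt lp; have [[ld _] _] := cd; have lg := @gdiff_linear R A.
set G := gdiff (phi (d x)).
set X1 := sweedler (fun a b => gdiff (t (koszul n a) (phi b))) x.
set X2 := sweedler (fun a b => t (koszul (n - 1) a) (gdiff (phi b))) x.
set X3 := sweedler (fun a b => t (koszul n (d a)) (phi b)) x.
set X4 := sweedler (fun a b => t (koszul (n - 1) a) (phi (d b))) x.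
set X5 := sweedler (fun a b => t (koszul (n - 1) a)
  (sweedler (fun b1 b2 => t (koszul n b1) (phi b2)) b)) x.
(* Coassociativity turns the twofold action of [t] on [phi] into the action of its cup square. *)
have X5E : X5 = sweedler (fun a c => sweedler (fun a1 a2 =>
    t (koszul (n - 1) a1) (t (koszul n a2) (phi c))) a) x.
  have bT : trilin (fun a b c => t (koszul (n - 1) a) (t (koszul n b) (phi c))).
    by split=> [a|b c]; lin.
  rewrite -(sweedlerA x bT).
  congr sweedler; apply: funext => a; apply: funext => b.
  by rewrite (sweedler_post b (bt.2 (koszul (n - 1) a))) //; lin.
have -> : sweedler (fun a b => curvature d t (koszul n a) (phi b)) x =
    X1 + X2 + ksign n *: X3 + X5.
  rewrite X5E /X1 /X2 /X3 -sweedlerZ -?sweedlerD; try lin.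
  congr sweedler; apply: funext => a; apply: funext => b.
  rewrite /curvature koszul_comp [-1 + n]addrC (koszul_hom _ _ cd.1) (linZ _ _ (bt.1 _)).
  rewrite scalerA mulrN1 ksignN ksignK scale1r; congr (_ + _).
  rewrite sweedler_koszul; last lin.
  congr sweedler; apply: funext => a1; apply: funext => a2.
  by rewrite koszul_comp [-1 + n]addrC.
have -> : twist_diff d t (n - 1) (twist_diff d t n phi) x =
  ksign (n + 1) *: G + X1 + ksign n *: (G + ksign (n + 1) *: phi (d (d x)) + (X3 + X4)) +
  (X2 + ksign (n + 1) *: X4 + X5).
  rewrite {1}/twist_diff {1}/twist_diff !(linD _ _ lg) (linZ _ _ lg) gdiffK add0r subrK.
  rewrite -(sweedler_post x lg); last lin.
  (* At [d x] the coderivation rule splits the action of [t] into [X3] and [X4]. *)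
  have -> : twist_diff d t n phi (d x) = G + ksign (n + 1) *: phi (d (d x)) + (X3 + X4).
    rewrite /twist_diff (coderivation_sweedler _ cd); last lin.
    rewrite sweedlerD; try lin.
    have -> // : X4 = sweedler (fun a b => t (koszul n (koszul (-1) a)) (phi (d b))) x.
    by congr sweedler; apply: funext => a; apply: funext => b; rewrite koszul_comp.
  congr (_ + _).
  have -> : (fun a b => t (koszul (n - 1) a) (twist_diff d t n phi b)) =
      (fun a b => t (koszul (n - 1) a) (gdiff (phi b)) +
         ksign (n + 1) *: t (koszul (n - 1) a) (phi (d b)) +
         t (koszul (n - 1) a) (sweedler (fun b1 b2 => t (koszul n b1) (phi b2)) b)).
    apply: funext => a; apply: funext => b.
    by rewrite /twist_diff !(linD _ _ (bt.2 _)) (linZ _ _ (bt.2 _)).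
  by rewrite !sweedlerD ?sweedlerZ //; lin.
have -> : @ksign R (n + 1) = - ksign n by rewrite ksignD [X in _ * X]expr1 mulrN1.
rewrite !scaleNr !scalerDr scalerN scalerA ksignK scale1r.
(* The permutation brings together the two opposite terms in [G] and the two in [X4]; the remaining
   terms are those of the curvature and - phi d d. *)
rewrite (AC ((2*(2*2))*3) ((1*3)*(6*8)*(2*7*5*9*4))) /=.
by rewrite addNr subrr !add0r.
Qed.

End TwistedDifferential.

(** * Test forms and convergence in Sym_A(V, A) *)

Section SymForms.
Variables (R : comNzRingType) (A : dgcalgType R) (V : dgmodOverType A).

Lemma counit_word (w : seq V) : counit (word w) = if w is [::] then 1 else 0.
Proof. exact: (slift_word _ (counit_gsymm V)). Qed.

(** Elements of A as forms concentrated on S^0[V]; they serve to detect the curvature.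
    Multilinearity is trivial, as both sides vanish on nonempty words. *)
Lemma Sym_A_const n (c : A) : homog n c -> Sym_A n (fun x : sym V => counit x *: c).
Proof.
move=> hc; split=> [|p q a s1 s2 v ha _]; last first.
  rewrite !counit_word; case: s1 => [|u s1] /=;
    by rewrite !scale0r (lin0 ((@dgmul_bilin R A).2 a)) scaler0.
split=> [|p x hx]; first exact: linear_scalel (@counit_linear R V).
have := counit_gproj p x; rewrite hx => ->; case: eqP => [->|_].
  by rewrite addr0; exact: homogZ.
by rewrite scale0r; exact: homog0.
Qed.

(** Brings the A-dual of V into Sym_A(V, A), to detect pr_V d d. Only one-letter words matter, and
    there A-linearity of [alpha] applies. *)
Lemma Sym_A_linear_form n (alpha : V -> A) :
  Hom_A n alpha -> Sym_A n (fun x : sym V => alpha (sym_linear_part x)).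
Proof.
move=> [[la ha] Aa]; have lp := @linear_part_linear R V; split=> [|p q a s1 s2 v hp hq].
  split=> [|p x hx]; first exact: linear_comp.
  by apply: ha; have := (@linear_part_hom R V).2 _ _ hx; rewrite add0r.
rewrite !linear_part_word.
case: s1 hq => [|u [|u' s1]] /= hq; [case: s2 => [|u s2]|..];
  rewrite ?(lin0 la) ?(lin0 ((@dgmul_bilin R A).2 a)) ?scaler0 //.
(* In any degree other than 0 the empty word would have counit 0, whereas its counit is 1. *)
have -> : q = 0; last by rewrite addr0 (Aa _ _ _ hp) mulrC.
apply/eqP/negP => /negP q0; have := counit_gproj q (word [::] : sym V).
by rewrite hq counit_one (negPf q0) => /eqP; rewrite oner_eq0.
Qed.

(** The longest word of a representative gives the bound. Its shape is that of [Sym_A_fil l.+1],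
    whose forms therefore vanish at [x]. *)
Lemma coaug_fil_bounded (x : sym V) : exists l : nat, coaug_fil (l.+1%:Z - 1) x.
Proof.
exists (\max_(p <- repr x) size p.2), (repr x); split; last exact: presentedE.
move=> p px; rewrite -[X in X - 1]natz -natr1 natz addrK lez_nat.
exact: (@leq_bigmax_seq _ _ predT (fun p : R * seq V => size p.2)).
Qed.

(** The diagonal of [x] is a finite combination of pure tensors, so the bounds for the individual
    left factors have a common maximum. *)
Lemma twist_sum (t : sym V -> A -> A) (tj : nat -> sym V -> A -> A) n (phi : sym V -> A) x :
  bilin t -> (forall j, (0 < j)%N -> bilin (tj j)) -> pointwise_sum tj t -> linear phi ->
  exists N : nat, forall k, (N <= k)%N ->
    sweedler (fun a b => t (koszul n a) (phi b)) x =
    \sum_(1 <= j < k.+1) sweedler (fun a b => tj j (koszul n a) (phi b)) x.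
Proof.
move=> bt btj st lp; rewrite /sweedler.
have bF (u : sym V -> A -> A) : bilin u -> bilin (fun a b => u (koszul n a) (phi b)).
  by move=> bu; lin.
elim/tensor_ind: (diag x) => [|r y z [N1 H1] [N2 H2]|a b].
- exists 0%N => k _; rewrite (lin0 (tlift_linear (bF _ bt))) big_nat big1 // => j /andP[j0 _].
  exact: (lin0 (tlift_linear (bF _ (btj _ j0)))).
- exists (maxn N1 N2) => k; rewrite geq_max => /andP[/H1 Hy /H2 Hz].
  rewrite (tlift_linear (bF _ bt)) Hy Hz scaler_sumr -big_split /=.
  apply: eq_big_nat => j /andP[j0 _].
  by rewrite (tlift_linear (bF _ (btj _ j0))).
have [N HN] := st (koszul n a); exists N => k /HN H.
rewrite tlift_tens; last exact: bF.
rewrite H fct_sumE; apply: eq_big_nat => j /andP[j0 _].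
by rewrite tlift_tens //; exact: (bF _ (btj _ j0)).
Qed.

Variables (pd : sym V -> sym V) (pdj : nat -> sym V -> sym V).
Variables (t : sym V -> A -> A) (tj : nat -> sym V -> A -> A).
Hypotheses (Hpd : filtered_coderivation pd pdj) (Ht : filtered_morphism t tj).

Lemma multi_der_sum n (phi : sym V -> A) x : linear phi ->
  exists N : nat, forall k, (N <= k)%N ->
    hom_diff n phi x + \sum_(1 <= j < k.+1) multi_der pdj tj j n phi x =
    twist_diff (fun x => sdiff x + pd x) t n phi x.
Proof.
move=> lp; have [_ cpj spd] := Hpd; have [ht htj st] := Ht.
have bt := der_hom_bilin ht.
have btj j : (0 < j)%N -> bilin (tj j) by move=> /htj[/der_hom_bilin].
have [N1 H1] := twist_sum n x bt btj st lp; have [N2 H2] := spd x.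
exists (maxn N1 N2) => k; rewrite geq_max => /andP[/H1 Hy /H2 Hz].
rewrite /twist_diff /hom_diff (linD _ _ lp) Hz Hy scalerDr.
rewrite -!addrA; congr (_ + (_ + _)).
rewrite (lin_sum _ _ lp) scaler_sumr -big_split /=.
apply: eq_big_nat => j /andP[j0 _]; rewrite /multi_der addrC; congr (_ + _).
by rewrite der_of_morphismE //; exact: btj.
Qed.

Hypothesis mda : multi_derivation_algebra (@Sym_A R A V) (@hom_one R A V) (@hom_mul R A V)
    (@Sym_A_fil R A V) (@hom_diff R A V) (multi_der pdj tj).

(** The square of the total differential vanishes on Sym_A(V, A), so the two terms of the formula
    for D (D phi) are equal there. *)
Lemma curvature_sweedler n (phi : sym V -> A) x : Sym_A n phi ->
  sweedler (fun a b => curvature (fun x => sdiff x + pd x) t (koszul n a) (phi b)) x =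
  phi (sdiff (sdiff x + pd x) + pd (sdiff x + pd x)).
Proof.
move=> Sphi; have [cpd _ _] := Hpd; have [ht _ _] := Ht.
have cd := coderivation_add (@sdiff_coderivation R V) cpd.
have [Dsum [SD cD D0]] := mda_sum mda.
(* Under either mode of convergence the abstract total differential is the concrete [twist_diff]. *)
have DE m psi : Sym_A m psi -> Dsum m psi = twist_diff (fun x => sdiff x + pd x) t m psi.
  move=> Spsi; have [[lp _] _] := Spsi; apply: funext => y.
  have [N1 H1] := multi_der_sum m y lp.
  suff [N HN] : exists N : nat, forall k, (N <= k)%N ->
      Dsum m psi y = hom_diff m psi y + \sum_(1 <= j < k.+1) multi_der pdj tj j m psi y.
    by rewrite (HN (maxn N N1)) ?leq_maxl // H1 // leq_maxr.
  case: cD => [/(_ _ _ Spsi) [N HN]|[_ /(_ _ _ Spsi) lim]].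
    by exists N => k /HN ->; rewrite fct_sumE.
  (* Convergence in the filtration becomes equality at [y]: far enough out, the difference vanishes
     on a stage containing [y]. *)
  have [l yl] := coaug_fil_bounded y; have [N HN] := lim l.+1.
  exists N => k /HN /(_ y yl) /eqP.
  by rewrite fct_sumE subr_eq0 => /eqP.
have := D0 n phi Sphi; rewrite (DE _ _ Sphi) DE; last by rewrite -DE //; exact: SD.
move/(congr1 (@^~ x)); rewrite twist_diff_square //; last 2 first.
- exact: der_hom_bilin ht.
- by case: Sphi => -[].
by move/eqP; rewrite subr_eq0 => /eqP.
Qed.

End SymForms.

(** * Vanishing of the curvature and of d d *)

Theorem theorem4p7 (R : comNzRingType) (iota : {rmorphism rat -> R})
    (A : dgcalgType R) (V : dgmodOverType A)
    (pd : sym V -> sym V) (pdj : nat -> sym V -> sym V)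
    (t : sym V -> (A -> A)) (tj : nat -> sym V -> (A -> A)) :
  filtered_coderivation pd pdj ->
  filtered_morphism t tj ->
  (forall j, (0 < j)%N -> passes_to_Sym_A (multi_der pdj tj j)) ->
  multi_derivation_algebra (@Sym_A R A V) (@hom_one R A V) (@hom_mul R A V)
    (@Sym_A_fil R A V) (@hom_diff R A V) (multi_der pdj tj) ->
  bidual_injective V ->
  coalg_differential (fun x => sdiff x + pd x) /\
  twisting_cochain iota (fun x => sdiff x + pd x) t.
Proof.
move=> Hpd Ht _ mda inj; have [cpd _ _] := Hpd; have [ht htj st] := Ht.
have bt := der_hom_bilin ht.
have cd := coderivation_add (@sdiff_coderivation R V) cpd.
have key := curvature_sweedler Hpd Ht mda.
set d := fun x => sdiff x + pd x in cd key *.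
have [[ld hd] _] := cd; have bc := curvature_bilin ld bt.
have curv0 x c : curvature d t x c = 0.
  suff: curvature d t x = (fun _ => 0) by move/(congr1 (@^~ c)).
  apply: linear_hom_eq => [|r u v|n e he]; first exact: bc.2.
    by rewrite scaler0 addr0.
  (* On the constant form [e] the term phi d d is zero, since the counit kills the image of [d]. The
     argument [koszul n x] later undoes the sign, [koszul n] being an involution. *)
  have := key _ _ (koszul n x) (Sym_A_const V he).
  rewrite (coderivation_counit _ cd) scale0r => K0.
  pose h y := curvature d t (koszul n y) e.
  have lh : linear h := linear_comp (bc.1 e) (@koszul_linear R _ n).
  (* The right factor enters only through its counit, so the sum collapses to the curvature
     itself. *)
  have hE : sweedler (fun a b => curvature d t (koszul n a) (counit b *: e)) (koszul n x) =
      h (koszul n x).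
    rewrite -[in RHS](sweedler_counitr (koszul n x)) -(sweedler_post _ lh);
      last exact: counitr_bilin.
    congr sweedler; apply: funext => a; apply: funext => b.
    by rewrite /h (linZ _ _ (bc.2 _)) (linZ _ _ (@koszul_linear R _ n)) (linZ _ _ (bc.1 _)).
  by rewrite -[x](koszul_even n) -koszul_comp -/(h _) -hE.
have dd0 : forall x, d (d x) = 0.
  have lp := @linear_part_linear R V.
  apply: (@even_coderivation_eq0 _ _ iota (fun x => d (d x))).
  - by lin.
  - by move=> K B x bB; exact: coderivation_square.
  - by move=> x; exact: coderivation_counit cd.
  move=> x; suff: (fun y => sym_linear_part (d (d y))) = (fun=> 0) by move/(congr1 (@^~ x)).
  apply: linear_hom_eq => [||p {}x hx]; [lin| |].
    by move=> r u v; rewrite scaler0 addr0.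
  have hdd : homog (0 + (-1 + (-1 + p))) (sym_linear_part (d (d x))).
    by apply: (@linear_part_hom R V).2; exact: hd _ _ (hd _ _ hx).
  (* Injectivity into the double dual compares homogeneous elements of equal degree, here pr_V d d x
     and 0. Pairing the former with [psi] gives a curvature term, already known to vanish. *)
  apply: (inj _ _ _ hdd (homog0 _ _)) => n psi Hpsi; rewrite /bidual.
  rewrite -(key _ _ x (Sym_A_linear_form Hpsi)).
  have -> : (fun a b => curvature d t (koszul n a) (psi (sym_linear_part b))) =
      (fun a b => 0 *: (curvature d t (koszul n a) (psi (sym_linear_part b)))).
    by apply: funext => a; apply: funext => b; rewrite curv0 scaler0.
  have lpsi := Hpsi.1.1; rewrite sweedlerZ; last by lin.
  by rewrite scale0r (lin0 lpsi).
split; split=> //.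
(* Each [tj j] with [j >= 1] vanishes on C_(j-1), which contains C_0 and hence the empty word. *)
- have [N /(_ N (leqnn N)) ->] := st (word [::]).
  rewrite big_nat big1 // => j /andP[j0 _]; have [_ + _] := htj _ j0; apply.
  exists [:: (1, [::])]; split=> [p|]; last by rewrite /lcomb big_seq1 scale1r.
  by rewrite inE => /eqP -> /=; lia.
move=> p x hx; apply: funext => c; rewrite -[RHS](curv0 x c) /curvature.
have cb := compose2_bilin bt.
(* The factor 1/2 cancels the doubling of the cup bracket. *)
rewrite der_bracket_cup // -scaler_nat scalerA -(rmorph_nat iota) -rmorphM mulVf //.
rewrite rmorph1 scale1r -(sweedler_eval x c cb).
rewrite (koszul_homog _ hx) (linZ _ _ (bt.1 _)).
(* The sign of the differential on derivations agrees with that of [koszul (-1)]: both are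
   (-1)^p. *)
have <- : ksign (-1 + p + 1) = ksign (-1 * p) :> R.
  by rewrite addrAC addNr add0r mulN1r ksignN.
by [].
Qed.
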